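(* (1) If $\tilde w\in\mathbb{O}_1$ and $\ell(\tilde w)=4k-1$ with $k\in\mathbb{N}_+$, then $$f_{\tilde w,\mathbb{O}}=\begin{cases}(k-i)(v-v^{-1})^3+(v-v^{-1}),&\mathbb{O}=\mathbb{O}_{i(\alpha_1+\alpha_2)}\ (1\leq i\leq k-1),\\ (k-i)(v-v^{-1})^3,&\mathbb{O}=\mathbb{O}_\lambda,\ \lambda\in E_{i(\alpha_1+\alpha_2)}\cup E'_{i(\alpha_1+\alpha_2)}\ (3\leq i\leq k-1),\\ (k-i)(v-v^{-1})^2,&\mathbb{O}=\mathbb{C}_i\text{ or }\mathbb{C}'_i\ (1\leq i\leq k-1),\\ k(v-v^{-1}),&\mathbb{O}=\mathbb{O}_2,\\ 1,&\mathbb{O}=\mathbb{O}_1,\\ 0,&\text{otherwise.}\end{cases}$$ (2) If $\tilde w\in\mathbb{O}_1$ and $\ell(\tilde w)=4k-3$ with $k\in\mathbb{N}_+$, then $$f_{\tilde w,\mathbb{O}}=\begin{cases}v-v^{-1},&\mathbb{O}=\mathbb{O}_{(k-1)(\alpha_1+\alpha_2)}\ (\text{for }k\geq2),\\ (k-1-i)(v-v^{-1})^3+(v-v^{-1}),&\mathbb{O}=\mathbb{O}_{i(\alpha_1+\alpha_2)}\ (1\leq i\leq k-2),\\ (k-1-i)(v-v^{-1})^3,&\mathbb{O}=\mathbb{O}_\lambda,\ \lambda\in E_{i(\alpha_1+\alpha_2)}\cup E'_{i(\alpha_1+\alpha_2)}\ (3\leq i\leq k-2),\\ (k-1-i)(v-v^{-1})^2,&\mathbb{O}=\mathbb{C}_i\text{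 or }\mathbb{C}'_i\ (1\leq i\leq k-2),\\ (k-1)(v-v^{-1}),&\mathbb{O}=\mathbb{O}_2,\\ 1,&\mathbb{O}=\mathbb{O}_1,\\ 0,&\text{otherwise.}\end{cases}$$
   Context: $W=\langle s_1,s_2\rangle$ is the finite Weyl group of type $A_2$; $\alpha_1,\alpha_2$ are the simple roots, identified with the simple coroots ($\langle\alpha_i,\alpha_i\rangle=2$, $\langle\alpha_1,\alpha_2\rangle=-1$); $Q=\mathbb{Z}\alpha_1\oplus\mathbb{Z}\alpha_2$; $P$ is the coweight lattice, $P_+$ its dominant elements; $\widetilde W=P\rtimes W$ with translations $t^\lambda$. $W_a=Q\rtimes W$ is the Coxeter group generated by $s_0=t^{\alpha_1+\alpha_2}s_1s_2s_1$, $s_1$, $s_2$; $\widetilde W=W_a\rtimes\langle\tau\rangle$ with $\tau^3=1$, $\tau s_0\tau^{-1}=s_1$, $\tau s_1\tau^{-1}=s_2$, $\tau s_2\tau^{-1}=s_0$; $\ell(w\tau^j)=\ell(w)$ for $w\in W_a$. $\mathbb{N}_+$ is the set of positive integers. Class polynomials: $\widetilde H$ is the algebra over $\mathbb{Z}[v,v^{-1}]$ with basis $T_{\tilde w}$ ($\tilde w\in\widetilde W$), $T_{\tilde x}T_{\tilde y}=T_{\tilde x\tilde y}$ if $\ell(\tilde x)+\ell(\tilde y)=\ell(\tilde x\tilde y)$, and $(T_s-v)(T_s+v^{-1})=0$ for $s\in\{s_0,s_1,s_2\}$. $[\widetilde H,\widetilde H]$ is the submodule spanned by commutators. For a conjugacy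 class $\mathbb{O}$ of $\widetilde W$, $T_{\mathbb{O}}$ is the image in $\widetilde H/[\widetilde H,\widetilde H]$ of $T_{w}$ for any minimal length $w\in\mathbb{O}$; by He–Nie this is well defined and the $T_{\mathbb{O}}$ form a basis. The class polynomials $f_{\tilde w,\mathbb{O}}$ are the unique coefficients with $T_{\tilde w}\equiv\sum_{\mathbb{O}}f_{\tilde w,\mathbb{O}}T_{\mathbb{O}}\bmod[\widetilde H,\widetilde H]$. Conjugacy classes of $\widetilde W$ in $W_a$: $\mathbb{O}_1=\{t^{k\alpha_1}s_1,\ t^{k\alpha_2}s_2,\ t^{k(\alpha_1+\alpha_2)}s_1s_2s_1\mid k\in\mathbb{Z}\}$; $\mathbb{O}_2=\{t^\lambda s_1s_2,\ t^\lambda s_2s_1\mid\lambda\in Q\}$; for $\lambda\in Q\cap P_+$, $\mathbb{O}_\lambda$ is the class of $t^\lambda$; for $i\in\mathbb{N}_+$, $\mathbb{C}_i=\{t^{k\alpha_1+i\alpha_2}s_1,\ t^{-i\alpha_1+k\alpha_2}s_2,\ t^{k\alpha_1+(k-i)\alpha_2}s_1s_2s_1\mid k\in\mathbb{Z}\}$, $\mathbb{C}'_i=\{t^{k\alpha_1-i\alpha_2}s_1,\ t^{i\alpha_1+k\alpha_2}s_2,\ t^{(k-i)\alpha_1+k\alpha_2}s_1s_2s_1\mid k\in\mathbb{Z}\}$. $Q_{sh}=Q\setminus\{k(\alpha_1+2\alpha_2),k(2\alpha_1+\alpha_2),k(\alpha_1-\alpha_2)\mid k\in\mathbb{Z}\}$;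 for $\lambda\in Q\cap P_+$, $E_\lambda=\{\lambda-i\alpha_1\mid i\in\mathbb{N}_+\}\cap P_+\cap Q_{sh}$ and $E'_\lambda=\{\lambda-i\alpha_2\mid i\in\mathbb{N}_+\}\cap P_+\cap Q_{sh}$. *)

(* Defs.v *)
From HB Require Import structures.
From mathcomp Require Import all_boot all_order all_algebra all_fingroup.
From mathcomp Require Import fraction.
From mathcomp Require Import boolp classical_sets functions cardinality fsbigop.
From mathcomp Require Import ring.

Set Implicit Arguments.
Unset Strict Implicit.
Unset Printing Implicit Defensive.

Import Order.TTheory GRing.Theory Num.Theory.

Local Open Scope classical_set_scope.
Local Open Scope ring_scope.

(* The ring Z[v, v^-1], as the subring { p / v^n } of the field of rational   *)
(* functions in one variable v.                                               *)

Definition laurent_pred : {pred {fraction {poly int}}} :=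
  fun f => `[< exists (p : {poly int}) n,
    f = tofrac p / tofrac ('X : {poly int}) ^+ n >].

Lemma X_frac_neq0 : tofrac ('X : {poly int}) != 0.
Proof. by rewrite tofrac_eq0 polyX_eq0. Qed.

Lemma laurent_subring : subring_closed laurent_pred.
Proof.
split.
- by apply/asboolP; exists 1, 0%N; rewrite tofrac1 expr0 divr1.
- move=> _ _ /asboolP[p [m ->]] /asboolP[q [n ->]]; apply/asboolP.
  exists (p * 'X^n - q * 'X^m), (m + n)%N.
  rewrite tofracB !tofracM !tofracXn exprD -mulNr addf_div ?expf_neq0 ?X_frac_neq0 //.
  by rewrite mulNr.
- move=> _ _ /asboolP[p [m ->]] /asboolP[q [n ->]]; apply/asboolP.
  by exists (p * q), (m + n)%N; rewrite tofracM exprD invfM mulrACA.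
Qed.

HB.instance Definition _ :=
  GRing.isSubringClosed.Build {fraction {poly int}} laurent_pred laurent_subring.

Record laurent := Laurent {
  laurent_val : {fraction {poly int}};
  _ : laurent_val \in laurent_pred }.

HB.instance Definition _ := [isSub for laurent_val].
HB.instance Definition _ := [Choice of laurent by <:].
HB.instance Definition _ := [SubChoice_isSubComNzRing of laurent by <:].

Lemma laurent_v_subproof : tofrac ('X : {poly int}) \in laurent_pred.
Proof. by apply/asboolP; exists 'X, 0%N; rewrite expr0 divr1. Qed.

Lemma laurent_vinv_subproof : (tofrac ('X : {poly int}))^-1 \in laurent_pred.
Proof. by apply/asboolP; exists 1, 1%N; rewrite tofrac1 expr1 div1r. Qed.

Definition v : laurent := Laurent laurent_v_subproof.
Definition vinv : laurent := Laurent laurent_vinv_subproof.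

Lemma v_vinv : v * vinv = 1.
Proof. by apply: val_inj; rewrite rmorphM rmorph1 /= mulfV ?X_frac_neq0. Qed.

(* A coweight lambda is represented by (<lambda, alpha1>, <lambda, alpha2>),  *)
(* that is, by its coordinates on the fundamental coweights.                  *)

Definition coweight : Type := (int * int)%type.
HB.instance Definition _ := GRing.Zmodule.on coweight.

Definition alpha1 : coweight := (2%:Z, - 1%:Z).
Definition alpha2 : coweight := (- 1%:Z, 2%:Z).
Definition theta : coweight := alpha1 + alpha2.
Definition omega1 : coweight := (1%:Z, 0).

(* P is identified with Z^3 / Z(1,1,1) by sending the class of (x0, x1, x2)   *)
(* to (x0 - x1, x1 - x2), and W with 'S_3 permuting the three coordinates.    *)
(* As (w * u) i = u (w i) for permutations, x |-> x \o w is a left action.    *)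

Definition lift3 (x : coweight) (i : 'I_3) : int :=
  [:: x.1 + x.2; x.2; 0]`_i.

Definition weyl_act (w : 'S_3) (x : coweight) : coweight :=
  (lift3 x (w 0) - lift3 x (w 1), lift3 x (w 1) - lift3 x (w 2)).

Definition r1 : 'S_3 := tperm 0 1.
Definition r2 : 'S_3 := tperm 1 2.

Lemma I3P (P : 'I_3 -> Prop) : P 0 -> P 1 -> P 2 -> forall i, P i.
Proof.
move=> P0 P1 P2 [[|[|[|//]]] lti].
- by have -> : Ordinal lti = 0 by apply: val_inj.
- by have -> : Ordinal lti = 1 by apply: val_inj.
- by have -> : Ordinal lti = 2 by apply: val_inj.
Qed.

Lemma lift3_act w x i : lift3 (weyl_act w x) i = lift3 x (w i) - lift3 x (w 2).
Proof.
elim/I3P: i; rewrite /weyl_act {1}/lift3 /=.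
- by rewrite addrA subrK.
- by [].
- by rewrite subrr.
Qed.

Lemma weyl_actM w u x : weyl_act (w * u)%g x = weyl_act w (weyl_act u x).
Proof.
rewrite {2}/weyl_act !lift3_act /weyl_act !permM.
by congr pair; rewrite opprB addrA subrK.
Qed.

Lemma weyl_act1 x : weyl_act 1%g x = x.
Proof.
by case: x => a b; rewrite /weyl_act !perm1 /lift3 /= addrK subr0.
Qed.

Lemma weyl_actD w x y : weyl_act w (x + y) = weyl_act w x + weyl_act w y.
Proof.
have liftD i : lift3 (x + y) i = lift3 x i + lift3 y i.
  by elim/I3P: i; rewrite /lift3 /= ?addr0 // addrACA.
by rewrite /weyl_act !liftD !opprD; congr pair; rewrite addrACA.
Qed.

Lemma coweightMz (x : coweight) n : x *~ n = (x.1 * n, x.2 * n).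
Proof.
rewrite [LHS]surjective_pairing -[(x *~ n).1]/(fst (x *~ n)).
by rewrite -[(x *~ n).2]/(snd (x *~ n)) !raddfMz -[n in RHS]intz !mulrzr.
Qed.

Lemma weyl_act_r1 x : weyl_act r1 x = x - alpha1 *~ x.1.
Proof.
rewrite coweightMz /weyl_act /r1 tpermL tpermR tpermD // /lift3 /=.
by case: x => a b /=; congr pair => /=; ring.
Qed.

Lemma weyl_act_r2 x : weyl_act r2 x = x - alpha2 *~ x.2.
Proof.
rewrite coweightMz /weyl_act /r2 tpermL tpermR tpermD // /lift3 /=.
by case: x => a b /=; congr pair => /=; ring.
Qed.

(* The extended affine Weyl group P >| W; ExtW lambda w is t^lambda w. *)

Record extW := ExtW { transl : coweight; linpart : 'S_3 }.

Definition extW_pair (x : extW) := (transl x, linpart x).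
Definition pair_extW (p : coweight * 'S_3) := ExtW p.1 p.2.
Lemma extW_pairK : cancel extW_pair pair_extW. Proof. by case. Qed.

HB.instance Definition _ := Choice.copy extW (can_type extW_pairK).

Definition extW_mul (x y : extW) : extW :=
  ExtW (transl x + weyl_act (linpart x) (transl y)) (linpart x * linpart y)%g.
Definition extW_one : extW := ExtW 0 1%g.
Definition extW_inv (x : extW) : extW :=
  ExtW (- weyl_act (linpart x)^-1%g (transl x)) (linpart x)^-1%g.

Lemma weyl_act0 w : weyl_act w 0 = 0.
Proof. by apply: (addrI (weyl_act w 0)); rewrite -weyl_actD !addr0. Qed.

Lemma extW_mulA : associative extW_mul.
Proof.
move=> [x w] [y u] [z t]; rewrite /extW_mul /= mulgA.
by rewrite weyl_actD weyl_actM addrA.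
Qed.

Lemma extW_mul1 : left_id extW_one extW_mul.
Proof. by case=> x w; rewrite /extW_mul /= weyl_act1 add0r mul1g. Qed.

Lemma extW_mulr1 : right_id extW_one extW_mul.
Proof. by case=> x w; rewrite /extW_mul /= weyl_act0 addr0 mulg1. Qed.

Lemma extW_mulV : left_inverse extW_one extW_inv extW_mul.
Proof. by case=> x w; rewrite /extW_mul /= addNr mulVg. Qed.

Lemma extW_mulrV : right_inverse extW_one extW_inv extW_mul.
Proof.
case=> x w; rewrite /extW_mul /extW_inv /= mulgV; congr ExtW.
apply: (addrI (weyl_act w (weyl_act w^-1%g x))).
rewrite addrCA -weyl_actD subrr weyl_act0.
by rewrite -weyl_actM mulgV weyl_act1 addr0.
Qed.

HB.instance Definition _ := isGroup.Build extW extW_mulA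
  extW_mul1 extW_mulr1 extW_mulV extW_mulrV.

Definition t (x : coweight) : extW := ExtW x 1%g.
Definition s1 : extW := ExtW 0 r1.
Definition s2 : extW := ExtW 0 r2.
Definition s0 : extW := (t theta * s1 * s2 * s1)%g.
Definition tau : extW := (t omega1 * s1 * s2)%g.

Definition aff_refl (i : 'I_3) : extW := nth 1%g [:: s0; s1; s2] i.
Definition aff_word (s : seq 'I_3) : extW := (\prod_(i <- s) aff_refl i)%g.

Lemma extW_ext (x y : extW) : transl x = transl y ->
  linpart x 0 = linpart y 0 -> linpart x 1 = linpart y 1 -> x = y.
Proof.
case: x y => [x w] [y u] /= -> e0 e1; congr ExtW.
apply/permP; elim/I3P => //.
have u2 i : u (u^-1 i)%g = i by rewrite permKV.
have inj i : w i = w 2 -> i = 2 by move/perm_inj.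
have := u2 (w 2); move: (u^-1 (w 2))%g.
elim/I3P => h //.
- by have := inj 0 (etrans e0 h).
- by have := inj 1 (etrans e1 h).
Qed.

Lemma r1E : ((r1 0 = 1) * (r1 1 = 0) * (r1 2 = 2))%type.
Proof. by rewrite /r1 tpermL tpermR tpermD. Qed.

Lemma r2E : ((r2 0 = 0) * (r2 1 = 2) * (r2 2 = 1))%type.
Proof. by rewrite /r2 tpermL tpermR tpermD. Qed.

Lemma tau3 : (tau ^+ 3)%g = 1%g.
Proof.
apply: extW_ext; first by rewrite /= /weyl_act !permM !perm1 !(r1E, r2E).
- by rewrite /= !permM !perm1 !(r1E, r2E, perm1).
- by rewrite /= !permM !perm1 !(r1E, r2E, perm1).
Qed.

Lemma tau_refl i : (tau * aff_refl i * tau^-1)%g = aff_refl (i + 1).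
Proof.
suff: (tau * aff_refl i)%g = (aff_refl (i + 1) * tau)%g.
  by move=> ->; rewrite mulgK.
elim/I3P: i; apply: extW_ext; rewrite /= /weyl_act ?permM ?perm1 ?(r1E, r2E) //.
Qed.

Definition expressible (n : nat) (x : extW) : bool :=
  [exists s : n.-tuple 'I_3, exists j : 'I_3, x == (aff_word s * tau ^+ j)%g].

Lemma expressibleP x : reflect
  (exists s j, x = (aff_word s * tau ^+ j)%g) `[< exists n, expressible n x >].
Proof.
apply: (iffP (asboolP _)) => [[n /existsP[s /existsP[j /eqP ->]]]|[s [j ->]]].
  by exists s, j.
exists (size s); apply/existsP; exists (in_tuple s).
apply/existsP; exists (inord (j %% 3)); rewrite inordK ?ltn_mod //.
by rewrite {1}(divn_eq j 3) expgnDr mulnC expgnA tau3 expg1n mul1g.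
Qed.

Lemma tau_word j s :
  (tau ^+ j * aff_word s)%g = (aff_word [seq (i + j%:R)%R | i <- s] * tau ^+ j)%g.
Proof.
elim: j s => [|j IHj] s.
  rewrite expg0 mul1g mulg1; congr aff_word; rewrite -[LHS]map_id.
  by apply: eq_map => i; rewrite addr0.
have tau1 u : (tau * aff_word u)%g = (aff_word [seq (i + 1)%R | i <- u] * tau)%g.
  elim: u => [|i u IHu]; first by rewrite /aff_word big_nil mulg1 mul1g.
  rewrite /aff_word /= !big_cons -!/(aff_word _) mulgA -(tau_refl i) -!mulgA.
  by rewrite -IHu mulKg.
rewrite expgS -mulgA IHj mulgA tau1 -map_comp -mulgA; congr (_ * _)%g.
by congr aff_word; apply: eq_map => i; rewrite /= -addrA natr1.
Qed.

Lemma length_ex x : exists n, expressible n x.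
Proof.
pose G x := exists s j, x = (aff_word s * tau ^+ j)%g.
suff: G x by move/expressibleP/asboolP.
have GM y z : G y -> G z -> G (y * z)%g.
  move=> [a [i ->]] [b [j ->]]; exists (a ++ [seq k + i%:R | k <- b]), (i + j)%N.
  rewrite expgnDr mulgA -(mulgA (aff_word a)) tau_word /aff_word big_cat.
  by rewrite !mulgA.
have Gr i : G (aff_refl i).
  by exists [:: i], 0%N; rewrite /aff_word big_seq1 mulg1.
have Gtau : G tau by exists [::], 1%N; rewrite /aff_word big_nil mul1g.
have G1 : G 1%g by exists [::], 0%N; rewrite /aff_word big_nil mul1g.
have Gs1 : G s1 by apply: (Gr 1).
have Gs2 : G s2 by apply: (Gr 2).
have tM a b : t (a + b) = (t a * t b)%g.
  by rewrite [RHS]/(extW_mul _ _) /extW_mul /= weyl_act1 mulg1.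
have GtZ a : G (t a) -> G (t (- a)) -> forall n : int, G (t (a *~ n)).
  move=> Ga Gna; have GN b : G (t b) -> forall n : nat, G (t (b *+ n)).
    move=> Gb; elim=> [|n IHn]; first by [].
    by rewrite mulrS tM; apply: GM.
  by case=> n; [apply: GN | rewrite NegzE mulrNz -mulNrz; apply: GN].
have Gt y : G (t y).
  have -> : y = omega1 *~ y.1 + (theta - omega1) *~ y.2.
    rewrite !coweightMz; case: y => a b; congr pair => /=; ring.
  rewrite tM; apply: (GM _ _); apply: (GtZ _).
  - have -> : t omega1 = (tau * s2 * s1)%g.
      by apply: extW_ext; rewrite /= /weyl_act ?permM ?perm1 ?(r1E, r2E) ?perm1.
    exact: (GM _ _ (GM _ _ Gtau Gs2) Gs1).
  - have -> : t (- omega1) = (s1 * s2 * tau * tau)%g.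
      by apply: extW_ext; rewrite /= /weyl_act ?permM ?perm1 ?(r1E, r2E) ?perm1.
    exact: (GM _ _ (GM _ _ (GM _ _ Gs1 Gs2) Gtau) Gtau).
  - have -> : t (theta - omega1) = (tau * tau * s1 * s2)%g.
      by apply: extW_ext; rewrite /= /weyl_act ?permM ?perm1 ?(r1E, r2E) ?perm1.
    exact: (GM _ _ (GM _ _ (GM _ _ Gtau Gtau) Gs1) Gs2).
  - have -> : t (- (theta - omega1)) = (s2 * s1 * tau)%g.
      by apply: extW_ext; rewrite /= /weyl_act ?permM ?perm1 ?(r1E, r2E) ?perm1.
    exact: (GM _ _ (GM _ _ Gs2 Gs1) Gtau).
suff Gw w : G (ExtW 0 w).
  case: x => y w; have -> : ExtW y w = (t y * ExtW 0 w)%g.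
    by apply: extW_ext; rewrite /= ?weyl_act0 ?addr0 ?mul1g.
  exact: GM.
have neq i j : i != j -> w i = w j -> False by move=> /eqP ij /perm_inj.
have E (u : 'S_3) (i j : 'I_3) : u 0 = i -> u 1 = j -> w 0 = i -> w 1 = j ->
    G (ExtW 0 u) -> G (ExtW 0 w).
  move=> <- <- e0 e1; suff -> : ExtW 0 u = ExtW 0 w by [].
  by apply: extW_ext.
have n01 := @neq 0 1 isT.
have [] : exists i j, w 0 = i /\ w 1 = j by exists (w 0), (w 1).
elim/I3P; case; elim/I3P => -[e0 e1]; try by case: n01; rewrite e0 e1.
- by apply: (E 1%g _ _ _ _ e0 e1); rewrite ?perm1.
- by apply: (E r2 _ _ _ _ e0 e1); rewrite ?r2E.
- by apply: (E r1 _ _ _ _ e0 e1); rewrite ?r1E.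
- apply: (E (r2 * r1)%g _ _ _ _ e0 e1); rewrite ?permM ?(r1E, r2E) //.
  suff e : (s2 * s1)%g = ExtW 0 (r2 * r1)%g by move: (GM _ _ Gs2 Gs1); rewrite e.
  by apply: extW_ext; rewrite /= ?weyl_act0 ?addr0.
- apply: (E (r1 * r2)%g _ _ _ _ e0 e1); rewrite ?permM ?(r1E, r2E) //.
  suff e : (s1 * s2)%g = ExtW 0 (r1 * r2)%g by move: (GM _ _ Gs1 Gs2); rewrite e.
  by apply: extW_ext; rewrite /= ?weyl_act0 ?addr0.
- apply: (E (r1 * r2 * r1)%g _ _ _ _ e0 e1); rewrite ?permM ?(r1E, r2E) //.
  suff e : (s1 * s2 * s1)%g = ExtW 0 (r1 * r2 * r1)%g by move: (GM _ _ (GM _ _ Gs1 Gs2) Gs1); rewrite e.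
  by apply: extW_ext; rewrite /= ?weyl_act0 ?addr0.
Qed.

(* Least number of simple reflections in an expression s_i1 ... s_in tau^j;   *)
(* since the extended group is W_a >| <tau>, len (w tau^j) is the Coxeter     *)
(* length of w for w in W_a.                                                  *)
Definition len (x : extW) : nat := ex_minn (length_ex x).

Definition root_lattice : set coweight :=
  [set x | exists a b : int, x = alpha1 *~ a + alpha2 *~ b].

Definition dominant : set coweight := [set x | 0 <= x.1 /\ 0 <= x.2].

Definition Q_sh : set coweight :=
  root_lattice `\` [set x | exists k : int,
    [\/ x = (alpha1 + alpha2 *+ 2) *~ k,
        x = (alpha1 *+ 2 + alpha2) *~ k
      | x = (alpha1 - alpha2) *~ k]].

Definition E_set (x : coweight) : set coweight :=
  [set x - alpha1 *+ i | i in [set i : nat | (0 < i)%N]] `&` dominant `&` Q_sh.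

Definition E'_set (x : coweight) : set coweight :=
  [set x - alpha2 *+ i | i in [set i : nat | (0 < i)%N]] `&` dominant `&` Q_sh.

Definition conj_class (x : extW) : set extW :=
  [set (g * x * g^-1)%g | g in [set: extW]].

Definition conj_classes : set (set extW) := range conj_class.

Definition O1 : set extW :=
  [set x | exists k : int,
    [\/ x = (t (alpha1 *~ k) * s1)%g,
        x = (t (alpha2 *~ k) * s2)%g
      | x = (t ((alpha1 + alpha2) *~ k) * (s1 * s2 * s1))%g]].

Definition O2 : set extW :=
  [set x | exists2 y, root_lattice y &
    x = (t y * (s1 * s2))%g \/ x = (t y * (s2 * s1))%g].

Definition O_ (x : coweight) : set extW := conj_class (t x).

Definition C_ (i : nat) : set extW :=
  [set x | exists k : int,
    [\/ x = (t (alpha1 *~ k + alpha2 *+ i) * s1)%g,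
        x = (t (- (alpha1 *+ i) + alpha2 *~ k) * s2)%g
      | x = (t (alpha1 *~ k + alpha2 *~ (k - i%:Z)) * (s1 * s2 * s1))%g]].

Definition C'_ (i : nat) : set extW :=
  [set x | exists k : int,
    [\/ x = (t (alpha1 *~ k - alpha2 *+ i) * s1)%g,
        x = (t (alpha1 *+ i + alpha2 *~ k) * s2)%g
      | x = (t (alpha1 *~ (k - i%:Z) + alpha2 *~ k) * (s1 * s2 * s1))%g]].

Definition min_length_in (O : set extW) (x : extW) : Prop :=
  O x /\ forall y, O y -> (len x <= len y)%N.

Record is_hecke_algebra (H : algType laurent) (T : extW -> H) : Prop := {
  hecke_span : forall h : H, exists (s : seq extW) (c : extW -> laurent),
    h = \sum_(x <- s) c x *: T x;
  hecke_free : forall (s : seq extW) (c : extW -> laurent), uniq s ->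
    \sum_(x <- s) c x *: T x = 0 -> forall x, x \in s -> c x = 0;
  hecke_mul : forall x y : extW, (len x + len y)%N = len (x * y)%g ->
    T x * T y = T (x * y)%g;
  hecke_quad : forall i : 'I_3,
    (T (aff_refl i) - v%:A) * (T (aff_refl i) + vinv%:A) = 0 }.

(* The submodule [H, H]. *)
Definition commutator_span (H : algType laurent) : set H :=
  [set h | exists (s : seq (H * H)) (c : H * H -> laurent),
    h = \sum_(p <- s) c p *: (p.1 * p.2 - p.2 * p.1)].

(* T_O is the image of T w for any element w of minimal length in O, hence    *)
(* the quantification over all choices m of minimal length representatives.   *)
Definition is_class_poly (H : algType laurent) (T : extW -> H) (w : extW)
    (f : set extW -> laurent) : Prop :=
  [/\ finite_set [set O | f O != 0],
      [set O | f O != 0] `<=` conj_classes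
    & forall m : set extW -> extW,
        (forall O, conj_classes O -> min_length_in O (m O)) ->
        commutator_span (T w - \sum_(O \in conj_classes) f O *: T (m O))].

(* class_poly T w O is f_{w,O}: the unique family satisfying is_class_poly    *)
(* (the default value 0 is only used if there is no such unique family).      *)
Definition class_poly (H : algType laurent) (T : extW -> H) (w : extW) :
    set extW -> laurent :=
  xget (fun=> 0) [set f | unique (is_class_poly T w) f].

(* Main.v *)
(* Existence is a reduction by conjugation with simple reflections: if
   l(s x s) = l(x) + 2 then T_{sxs} = T_x + z T_{sx} in the cocenter, where
   z = v - v^-1. Let a_k, g_n(k) and R_m be the images of t^{k alpha1} s1,
   t^{k alpha1 + n alpha2} s1 and t^{-m theta} s2 s1. Then
     a_{-m} = a_m + z O_{m theta},            a_{m+1} = a_{-m} + z R_m,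
     R_m = R_{m-1} + z (g_m(0) + g_{-m}(0)),
   and moving k towards the middle of the axis of a glide reflection expresses
   g_m(0) and g_{-m}(0) as C_m and C'_m plus z times the classes O_lambda with
   lambda = m theta - j alpha1, resp. m theta - j alpha2, where 0 < 2j < m, and
   with lambda = m theta for g_m(0) only.

   Uniqueness needs traces separating all the conjugacy classes of the extended
   group. They are traces, composed with a commuting translation, of the modules
   induced from parabolic subalgebras, realised over Z / N as free modules on
   finite sets of alcoves with a semi-infinite order; at v = 1 these are
   permutation representations, whose characters separate the classes, and a
   linear relation over Z[v, v^-1] can be divided by powers of v - 1.         *)
From HB Require Import structures.
Require Import Defs.
From mathcomp Require Import all_boot all_order all_algebra all_fingroup.
From mathcomp Require Import boolp classical_sets functions cardinality fsbigop.
From mathcomp Require Import ring zify.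
Set Implicit Arguments.
Unset Strict Implicit.
Unset Printing Implicit Defensive.

Import Order.TTheory GRing.Theory Num.Theory.

Local Open Scope classical_set_scope.
Local Open Scope ring_scope.

(** * The length function *)

(** [H] is known only through its basis [T], and products are prescribed only when lengths add. A
    module must therefore be defined on each [T x] along a reduced expression of [x], and
    Matsumoto's theorem makes the result independent of that choice. Traces require finite rank,
    which is why translations are taken modulo [N.+2]. Lengths lose their meaning there, but
    orienting a wall by the sign of the linear part of its affine root is insensitive to
    translations, so it survives the quotient and the Hecke relations still hold. The modulus is
    chosen after the linear relation under study: finitely many classes occur in it, and a large
    modulus separates them. A plain trace would count fixed points at v = 1; composing with a
    commuting translation counts instead the points that are moved by a prescribed amount. On the
    side of existence, the agreement of all minimal length elements of a class in the cocenter is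
    verified by explicit conjugations for each class that occurs. *)

Lemma S3P (P : 'S_3 -> Prop) : P 1%g -> P r1 -> P r2 -> P (r1 * r2)%g ->
  P (r2 * r1)%g -> P (r1 * r2 * r1)%g -> forall w, P w.
Proof.
move=> P1 Pr1 Pr2 Pr12 Pr21 Pr121 w.
have [i [j [e0 e1]]] : exists i j, w 0 = i /\ w 1 = j by exists (w 0), (w 1).
have E (u : 'S_3) : u 0 = i -> u 1 = j -> P u -> P w.
  move=> u0 u1; suff -> : w = u by [].
  have /(congr1 linpart) := @extW_ext (ExtW 0 w) (ExtW 0 u) erefl
    (etrans e0 (esym u0)) (etrans e1 (esym u1)).
  by [].
have {e0 e1} ij : i <> j by rewrite -e0 -e1 => /perm_inj.
move: i j ij E; elim/I3P; elim/I3P => // _ E.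
- by apply: (E 1%g); rewrite ?perm1.
- by apply: (E r2); rewrite ?r2E.
- by apply: (E r1); rewrite ?r1E.
- by apply: (E (r2 * r1)%g); rewrite ?permM ?(r1E, r2E).
- by apply: (E (r1 * r2)%g); rewrite ?permM ?(r1E, r2E).
- by apply: (E (r1 * r2 * r1)%g); rewrite ?permM ?(r1E, r2E).
Qed.

Lemma r1V : (r1^-1)%g = r1. Proof. exact: tpermV. Qed.
Lemma r2V : (r2^-1)%g = r2. Proof. exact: tpermV. Qed.
Definition permE3 := (@invMg 'S_3, r1V, r2V, @invg1 'S_3, @permM 'I_3, @perm1 'I_3, r1E, r2E).

Lemma extW_mulE x y : (x * y)%g =
  ExtW (transl x + weyl_act (linpart x) (transl y)) (linpart x * linpart y)%g.
Proof. by []. Qed.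

Lemma s0E : s0 = ExtW theta (r1 * r2 * r1)%g.
Proof. by apply: extW_ext; rewrite /= ?permE3 // !weyl_act0 !addr0. Qed.

Lemma tauE : tau = ExtW omega1 (r1 * r2)%g.
Proof. by apply: extW_ext; rewrite /= ?permE3 // !weyl_act0 !addr0. Qed.

(* [window x] lists the values of [x] seen as an affine permutation of Z, up  *)
(* to a common translation; [rootv x i] is 3 times the value of [x] on the    *)
(* simple affine root [alpha_i] at the barycentre of the fundamental alcove.  *)
Definition window (x : extW) (i : 'I_3) : int :=
  ((linpart x)^-1%g i : nat)%:Z + 3 * lift3 (transl x) ((linpart x)^-1%g i).

Definition rootv (x : extW) (i : 'I_3) : int :=
  [:: window x 0 - window x 2 + 3; window x 1 - window x 0;
      window x 2 - window x 1]`_i.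

Lemma rootv_sum x : rootv x 0 + rootv x 1 + rootv x 2 = 3.
Proof. rewrite /rootv /=; lia. Qed.

Lemma lift3D x y i : lift3 (x + y) i = lift3 x i + lift3 y i.
Proof. by elim/I3P: i; rewrite /lift3 /= ?addr0 // addrACA. Qed.

Lemma lift30 i : lift3 0 i = 0.
Proof. by elim/I3P: i. Qed.

Lemma aff_refl0 : aff_refl 0 = s0. Proof. by []. Qed.
Lemma aff_refl1 : aff_refl 1 = s1. Proof. by []. Qed.
Lemma aff_refl2 : aff_refl 2 = s2. Proof. by []. Qed.

(** Any two nodes of the affine diagram are joined by a simple edge, so s_i sends the simple affine
    root alpha_j to alpha_j + alpha_i when j differs from i. *)
Lemma rootv_refl x i j : rootv (x * aff_refl i)%g j =
  if j == i then - rootv x i else rootv x j + rootv x i.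
Proof.
have W y k : window (x * y)%g k = let h := (linpart x)^-1%g ((linpart y)^-1%g k) in
    (h : nat)%:Z + 3 * (lift3 (transl x) h
     + (lift3 (transl y) ((linpart y)^-1%g k) - lift3 (transl y) (linpart x 2))).
  by rewrite /window extW_mulE /= invMg permM lift3D lift3_act permKV.
have [a [e0 [e1 e2]]] : exists a, lift3 theta (linpart x 2) = a /\
  (lift3 theta 0 = 2 /\ lift3 theta 1 = 1) /\ lift3 theta 2 = 0 by eexists.
move: e1 => [e1 e3].
move: i j; elim/I3P; elim/I3P;
  rewrite ?aff_refl0 ?aff_refl1 ?aff_refl2 ?s0E /rootv /= !W /= ?permE3 ?e0 ?e1 ?e2 ?e3
   /window ?lift30; ring.
Qed.

(** The barycentre of an alcove lies on no wall: the entries of a window are distinct modulo 3. Sign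
    tests and floors below thus never meet a boundary case. *)
Lemma rootv_mod3 x i : (rootv x i %% 3)%Z != 0.
Proof.
pose p := (linpart x)^-1%g.
have D a b (c : int) : a != b -> ((window x a - window x b + 3 * c) %% 3)%Z != 0.
  move=> ab; have : (p a != p b :> nat) by rewrite (inj_eq val_inj) (inj_eq perm_inj).
  rewrite /window; have [] := (ltn_ord (p a), ltn_ord (p b)).
  rewrite -/p; move: (lift3 _ (p a)) (lift3 _ (p b)) (p a : nat) (p b : nat).
  clear; lia.
by elim/I3P: i; rewrite /rootv /=; [have := D 0 2 1 isT | have := D 1 0 0 isT
  | have := D 2 1 0 isT]; rewrite ?mulr1 ?mulr0 ?addr0.
Qed.

Lemma rootv_tau x i : rootv (x * tau)%g i = rootv x (i + 1).
Proof.
have W k : window (x * tau)%g k = let h := (linpart x)^-1%g ((r1 * r2)^-1%g k) in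
    (h : nat)%:Z + 3 * (lift3 (transl x) h
     + (lift3 omega1 ((r1 * r2)^-1%g k) - lift3 omega1 (linpart x 2))).
  by rewrite /window tauE extW_mulE /= [in LHS]invMg permM lift3D lift3_act permKV.
have [a [e0 [e1 e2]]] : exists a, lift3 omega1 (linpart x 2) = a /\
  (lift3 omega1 0 = 1 /\ lift3 omega1 1 = 0) /\ lift3 omega1 2 = 0 by eexists.
move: e1 => [e1 e3].
have [h1 [h2 h3]]: ((r1 * r2)^-1%g 0 = 1 /\ (r1 * r2)^-1%g 1 = 2 /\ (r1 * r2)^-1%g 2 = 0).
  by rewrite !permE3.
move: i; elim/I3P; rewrite /rootv /= !W /= !(h1,h2,h3) ?e0 ?e1 ?e2 ?e3 /window; ring.
Qed.

Lemma I3_succ :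
  (((1 + 1)%R = 2%R :> 'I_3) * ((2 + 1)%R = 0%R :> 'I_3))%type.
Proof. by split; apply: val_inj. Qed.

(** Each term counts the hyperplanes, for one of the positive roots alpha1, alpha2, theta, that
    separate an alcove from the fundamental one; [rootv] carries a factor 3, hence the divisions. *)
Definition alcove_dist (x : extW) : nat :=
  `|(rootv x 1%R %/ 3)%Z| + `|(rootv x 2%R %/ 3)%Z|
  + `|((rootv x 1%R + rootv x 2%R) %/ 3)%Z|.

Lemma rootv0E x : rootv x 0 = 3 - rootv x 1 - rootv x 2.
Proof. by have := rootv_sum x; lia. Qed.

Lemma alcove_dist_refl x i : alcove_dist (x * aff_refl i)%g =
  if 0 < rootv x i then (alcove_dist x).+1 else (alcove_dist x).-1.
Proof.
move: (rootv_mod3 x 0) (rootv_mod3 x 1) (rootv_mod3 x 2).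
rewrite /alcove_dist !rootv_refl.
elim/I3P: i => /=; rewrite ?rootv0E; move: (rootv x 1) (rootv x 2) => a b; case: ltP; lia.
Qed.

Lemma alcove_dist_gt0 x i : rootv x i <= 0 -> (0 < alcove_dist x)%N.
Proof.
move: (rootv_mod3 x 0) (rootv_mod3 x 1) (rootv_mod3 x 2).
by rewrite /alcove_dist; elim/I3P: i => /=; rewrite ?rootv0E; lia.
Qed.

Lemma alcove_dist_tau x : alcove_dist (x * tau)%g = alcove_dist x.
Proof.
move: (rootv_mod3 x 0) (rootv_mod3 x 1) (rootv_mod3 x 2).
rewrite /alcove_dist !rootv_tau !I3_succ rootv0E; lia.
Qed.

Lemma len_leP x n : reflect
  (exists s j, x = (aff_word s * tau ^+ j)%g /\ (size s <= n)%N) (len x <= n)%N.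
Proof.
apply: (iffP idP) => [le_xn|[s [j [-> le_sn]]]]; last first.
  apply: leq_trans le_sn; rewrite /len; case: ex_minnP => k _; apply.
  apply/existsP; exists (in_tuple s).
  apply/existsP; exists (inord (j %% 3)); rewrite inordK ?ltn_mod //.
  by rewrite {1}(divn_eq j 3) expgnDr mulnC expgnA tau3 expg1n mul1g.
move: le_xn; rewrite /len; case: ex_minnP => k /existsP[s /existsP[j /eqP ->]] _ le_kn.
by exists s, j; rewrite size_tuple.
Qed.

Lemma rootv_tauX j i : rootv (tau ^+ j)%g i = 1.
Proof.
elim: j i => [|j IHj] i; last by rewrite expgSr rootv_tau IHj.
by elim/I3P: i; rewrite expg0 /rootv /window /= !permE3.
Qed.

Lemma alcove_dist_eq0 x : alcove_dist x = 0%N -> exists j, x = (tau ^+ j)%g.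
Proof.
move=> x0.
have d1 : forall i, rootv x i = 1.
  have := rootv_mod3 x 0; have := rootv_mod3 x 1; have := rootv_mod3 x 2.
  have h i : 0 < rootv x i by rewrite ltNge; apply/negP => /alcove_dist_gt0; rewrite x0.
  have := h 0; have := h 1; have := h 2; have := rootv_sum x.
  move=> ? ? ? ? ? ? ?; elim/I3P; lia.
have := d1 1; have := d1 2; rewrite /rootv /window /=; clear.
case: x => [[a b] w] /=.
elim/S3P: w; rewrite ?permE3 /lift3 /= => h2 h1; try lia.
- exists 0%N; rewrite expg0; apply: extW_ext; rewrite /= ?permE3 //; congr pair => /=; lia.
- exists 1%N; rewrite expg1 tauE; apply: extW_ext; rewrite /= ?permE3 //; congr pair => /=; lia.
- exists 2%N; rewrite expgS expg1 tauE; apply: extW_ext; rewrite /= ?permE3 //.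
  rewrite /weyl_act !permE3 /lift3 /=; congr pair => /=; lia.
Qed.

Lemma aff_reflK i : (aff_refl i * aff_refl i)%g = 1%g.
Proof.
elim/I3P: i; rewrite ?aff_refl0 ?aff_refl1 ?aff_refl2 ?s0E; apply: extW_ext;
  by rewrite /= ?permE3 // /weyl_act ?permE3 /lift3.
Qed.

Lemma mulg_reflK x i : (x * aff_refl i * aff_refl i)%g = x.
Proof. by rewrite -mulgA aff_reflK mulg1. Qed.

Lemma aff_word_rcons s i : aff_word (rcons s i) = (aff_word s * aff_refl i)%g.
Proof. by rewrite /aff_word big_rcons. Qed.

Lemma rootv_neq0 x i : rootv x i != 0.
Proof. by apply: contraTneq (rootv_mod3 x i) => ->. Qed.

Lemma has_descent x : (0 < alcove_dist x)%N -> exists i, rootv x i < 0.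
Proof.
move=> x_gt0; apply: contrapT => /forallNP d.
have h i : 0 < rootv x i.
  by rewrite lt_neqAle eq_sym rootv_neq0 leNgt; apply/negP => /d.
move: (h 0) (h 1) (h 2) (rootv_sum x) x_gt0; rewrite /alcove_dist.
have -> : (`|(rootv x 1%R %/ 3)%Z| + `|(rootv x 2%R %/ 3)%Z| +
   `|((rootv x 1%R + rootv x 2%R) %/ 3)%Z|)%N = 0%N.
  by move: (h 0) (h 1) (h 2) (rootv_sum x); lia.
by [].
Qed.

(** Walking down descents spells [x] with [alcove_dist x] reflections; conversely, each letter of a
    word changes the distance by one step at most. *)
Lemma len_dist x : len x = alcove_dist x.
Proof.
apply/eqP; rewrite eqn_leq; apply/andP; split.
  have [n] := ubnPeq (alcove_dist x); elim: n x => [|n IHn] x /eqP xn.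
    have [j ->] := alcove_dist_eq0 xn.
    by apply/len_leP; exists [::], j; rewrite /aff_word big_nil mul1g.
  have [i xi] : exists i, rootv x i < 0 by apply: has_descent; rewrite xn.
  have /IHn/len_leP[s [j [e le_sn]]] : alcove_dist (x * aff_refl i)%g == n.
    by rewrite alcove_dist_refl ltNge ltW // xn.
  (* The new reflection stands to the right of tau^j; moving it to the left of tau^j adds j to its
     index. *)
  apply/len_leP; exists (rcons s (i + j%:R)), j; rewrite size_rcons; split=> //.
  rewrite -(mulg_reflK x i) e aff_word_rcons -!mulgA; congr mul.
  by have := tau_word j [:: i]; rewrite /aff_word !big_seq1 => ->.
have /len_leP[s [j [-> le_sn]]] := leqnn (len x).
apply: leq_trans le_sn.
have -> : alcove_dist (aff_word s * tau ^+ j)%g = alcove_dist (aff_word s).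
  elim: j => [|j IHj]; first by rewrite mulg1.
  by rewrite expgSr mulgA alcove_dist_tau.
elim/last_ind: s => [|s i IHs].
  rewrite /aff_word big_nil.
  by have := rootv_tauX 0; rewrite expg0 /alcove_dist => e; rewrite !e.
rewrite aff_word_rcons alcove_dist_refl size_rcons; case: ifP => _; lia.
Qed.

Lemma len_refl x i : len (x * aff_refl i)%g =
  if 0 < rootv x i then (len x).+1 else (len x).-1.
Proof. by rewrite !len_dist alcove_dist_refl. Qed.

Lemma len_tau x : len (x * tau)%g = len x.
Proof. by rewrite !len_dist alcove_dist_tau. Qed.

Lemma len_eq0 x : len x = 0%N -> exists j, x = (tau ^+ j)%g.
Proof. by rewrite len_dist; apply: alcove_dist_eq0. Qed.

(** * Matsumoto's theorem and representations of the Hecke algebra *)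

(** [hecke_span] yields lists with possible repetitions while [hecke_free] asks for duplicate-free
    ones; collecting multiplicities passes from the former to the latter. *)
Lemma sum_count (V : nmodType) (I : eqType) (s u : seq I) (F : I -> V) :
  uniq u -> {subset s <= u} ->
  \sum_(i <- s) F i = \sum_(i <- u) F i *+ count_mem i s.
Proof.
move=> uu; elim: s => [|a s IHs] su; first by rewrite big_nil big1.
rewrite big_cons IHs => [|x xs]; last by apply: su; rewrite inE xs orbT.
rewrite [in RHS](eq_bigr (fun i => F i *+ (a == i) + F i *+ count_mem i s)) => [|i _].
  rewrite big_split /=; congr (_ + _).
  rewrite (bigD1_seq a) ?su ?mem_head //= eqxx big1 ?addr0 // => i.
  by rewrite eq_sym => /negPf ->.
by rewrite /= mulrnDr.
Qed.

Section Hecke.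
Variables (H : algType laurent) (T : extW -> H) (HT : is_hecke_algebra T).

Lemma hecke_sum_eq0 (V : lmodType laurent) (phi : extW -> V) s c s' c' :
  \sum_(x <- s) c x *: T x = \sum_(x <- s') c' x *: T x ->
  \sum_(x <- s) c x *: phi x = \sum_(x <- s') c' x *: phi x.
Proof.
pose u := undup (s ++ s').
have uu : uniq u by apply: undup_uniq.
have su : {subset s <= u} by move=> x xs; rewrite mem_undup mem_cat xs.
have s'u : {subset s' <= u} by move=> x xs; rewrite mem_undup mem_cat xs orbT.
rewrite !(sum_count _ uu su) !(sum_count _ uu s'u) => /eqP.
rewrite -subr_eq0 -sumrB => /eqP e; apply/eqP; rewrite -subr_eq0 -sumrB.
pose d x := c x *+ count_mem x s - c' x *+ count_mem x s'.
have dE (W : lmodType laurent) (psi : extW -> W) x :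
    c x *: psi x *+ count_mem x s - c' x *: psi x *+ count_mem x s' = d x *: psi x.
  by rewrite scalerBl !scalerMnl.
under eq_bigr do rewrite dE; apply/eqP.
have d0 : forall x, x \in u -> d x = 0.
  by apply: (hecke_free HT uu); rewrite -[RHS]e; apply: eq_bigr => x _; rewrite dE.
by rewrite big_seq big1 // => x /d0 ->; rewrite scale0r.
Qed.

Lemma hecke_lift (V : lmodType laurent) (phi : extW -> V) :
  exists rho : {linear H -> V}, forall x, rho (T x) = phi x.
Proof.
have /choice[sc scP] : forall h : H, exists p : seq extW * (extW -> laurent),
    h = \sum_(x <- p.1) p.2 x *: T x.
  by move=> h; have [s [c ->]] := hecke_span HT h; exists (s, c).
pose rho h := \sum_(x <- (sc h).1) (sc h).2 x *: phi x.
have rhoE s c : rho (\sum_(x <- s) c x *: T x) = \sum_(x <- s) c x *: phi x.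
  by apply: hecke_sum_eq0; rewrite -scP.
have lin : linear rho.
  move=> a h k.
  have [[s c] /= hE] : {p | h = \sum_(x <- p.1) p.2 x *: T x} by exists (sc h).
  have [[s' c'] /= kE] : {p | k = \sum_(x <- p.1) p.2 x *: T x} by exists (sc k).
  rewrite hE kE !rhoE.
  pose u := undup (s ++ s').
  have uu : uniq u by apply: undup_uniq.
  have su : {subset s <= u} by move=> x xs; rewrite mem_undup mem_cat xs.
  have s'u : {subset s' <= u} by move=> x xs; rewrite mem_undup mem_cat xs orbT.
  rewrite !(sum_count _ uu su) !(sum_count _ uu s'u) !scaler_sumr -!big_split /=.
  pose d x := a * (c x *+ count_mem x s) + c' x *+ count_mem x s'.
  have dE (W : lmodType laurent) (psi : extW -> W) x :
      a *: (c x *: psi x *+ count_mem x s) + c' x *: psi x *+ count_mem x s'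
      = d x *: psi x.
    by rewrite scalerDl -scalerA !scalerMnl.
  under eq_bigr do rewrite dE; under [RHS]eq_bigr do rewrite dE.
  exact: rhoE.
pose L := GRing.isLinear.Build laurent H V *:%R rho lin.
pose r : {linear H -> V} := HB.pack rho L.
exists r => x; rewrite -[r _]/(rho (T x)).
by have := rhoE [:: x] (fun=> 1); rewrite !big_seq1 !scale1r.
Qed.

Lemma hecke_ind (P : H -> Prop) : (forall a h k, P h -> P k -> P (a *: h + k)) ->
  P 0 -> (forall x, P (T x)) -> forall h, P h.
Proof.
move=> Plin P0 PT h; have [s [c ->]] := hecke_span HT h.
by elim/big_rec: _ => // x k _ Pk; apply: Plin.
Qed.

Definition zz : laurent := v - vinv.

Lemma hecke_sqr i : T (aff_refl i) * T (aff_refl i) = 1 + zz *: T (aff_refl i).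
Proof.
have := hecke_quad HT i; set t := T _ => /eqP.
rewrite mulrDr !mulrBl -scalerAr -!scalerAl !mulr1 !mul1r scalerA v_vinv scale1r.
move=> /eqP e; apply/eqP; rewrite -subr_eq0 -e /zz scalerBl opprD opprB.
by rewrite (addrC (- 1)) (addrC (vinv *: t)) -!addrA.
Qed.

Lemma hecke_one : T 1%g = 1.
Proof.
have T1 x : T 1%g * T x = T x.
  by rewrite (hecke_mul HT) ?mul1g //; have := len_dist 1%g; have := rootv_tauX 0;
     rewrite expg0 /alcove_dist => e ->; rewrite !e.
have T1h h : T 1%g * h = h.
  elim/hecke_ind: h => [a h k hh kk||x]; rewrite ?mulr0 ?T1 //.
  by rewrite mulrDr -scalerAr hh kk.
by rewrite -[RHS]T1h mulr1.
Qed.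

Lemma len1 : len 1%g = 0%N.
Proof.
by have := rootv_tauX 0; rewrite expg0 len_dist /alcove_dist => e; rewrite !e.
Qed.

Lemma len_mul_tauX x j : len (x * tau ^+ j)%g = len x.
Proof.
elim: j => [|j IHj]; first by rewrite mulg1.
by rewrite expgSr mulgA len_tau.
Qed.

Lemma len_tauX j : len (tau ^+ j)%g = 0%N.
Proof. by rewrite -(mul1g (tau ^+ j)%g) len_mul_tauX len1. Qed.

Lemma len_aff_refl i : len (aff_refl i) = 1%N.
Proof. by rewrite -(mul1g (aff_refl i)) len_refl (rootv_tauX 0) len1. Qed.

Lemma hecke_tau x j : T x * T (tau ^+ j)%g = T (x * tau ^+ j)%g.
Proof. by rewrite (hecke_mul HT) // len_tauX len_mul_tauX addn0. Qed.

Lemma hecke_refl x i : 0 < rootv x i -> T x * T (aff_refl i) = T (x * aff_refl i)%g.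
Proof. by move=> xi; rewrite (hecke_mul HT) // len_refl xi len_aff_refl addn1. Qed.

Lemma hecke_refl_down x i : rootv x i < 0 ->
  T x * T (aff_refl i) = T (x * aff_refl i)%g + zz *: T x.
Proof.
move=> xi; have yi : 0 < rootv (x * aff_refl i)%g i.
  by rewrite rootv_refl eqxx oppr_gt0.
rewrite -{1}(mulg_reflK x i) -(hecke_refl yi) -mulrA hecke_sqr mulrDr mulr1.
by rewrite -scalerAr hecke_refl // mulg_reflK.
Qed.

End Hecke.

(* The class of x in P / Q, identified with Z / 3. *)
Definition coset_rep (x : extW) : 'I_3 := ((transl x).1 + 2 * (transl x).2)%:~R.

Lemma weyl_act_sum w y : (weyl_act w y).1 + 2 * (weyl_act w y).2 =
  y.1 + 2 * y.2 - 3 * lift3 y (w 2).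
Proof.
by case: y => a b; elim/S3P: w; rewrite /weyl_act /= ?permE3 /lift3 /=; lia.
Qed.

Lemma coset_repM x y : coset_rep (x * y)%g = coset_rep x + coset_rep y.
Proof.
have I3 k : (3 * k)%:~R = 0 :> 'I_3.
  have I30 : 3%:~R = 0 :> 'I_3 by apply: val_inj.
  by rewrite mulrzA I30 mul0rz.
rewrite /coset_rep extW_mulE /= mulrDr addrACA weyl_act_sum.
by rewrite !mulrzDr mulrNz I3 subr0.
Qed.

Lemma coset_rep_tauX j : coset_rep (tau ^+ j)%g = j%:R.
Proof.
elim: j => [|j IHj]; first by apply: val_inj.
rewrite expgSr coset_repM IHj -natr1; congr (_ + _).
by rewrite tauE; apply: val_inj.
Qed.

Lemma I3_natr_eq j k : (j%:R == k%:R :> 'I_3) = (j %% 3 == k %% 3)%N.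
Proof. by rewrite -val_eqE /= !Zp_nat. Qed.

Lemma refl_braid i j : i != j ->
  (aff_refl i * aff_refl j * aff_refl i = aff_refl j * aff_refl i * aff_refl j)%g.
Proof.
move: i j; elim/I3P; elim/I3P => // _; rewrite ?aff_refl0 ?aff_refl1 ?aff_refl2 ?s0E;
apply: extW_ext; rewrite /= ?permE3 //; rewrite /weyl_act ?permE3 /lift3 //.
Qed.

Section Representation.
Variables (n : nat) (M : 'I_3 -> 'M[laurent]_n) (Mt : 'M[laurent]_n).
Hypothesis Mquad : forall i, M i *m M i = 1%:M + zz *: M i.
Hypothesis Mbraid : forall i j, i != j ->
  M i *m M j *m M i = M j *m M i *m M j.
Hypothesis Mtau : forall i, Mt *m M i = M (i + 1) *m Mt.
Hypothesis Mtau3 : Mt *m Mt *m Mt = 1%:M.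

Definition Mtau_exp j : 'M[laurent]_n := iter j (mulmxr Mt) 1%:M.

(** A relation, because a given [x] has several reduced expressions; Matsumoto's theorem is the
    statement that it is functional. *)
Inductive reduced_value : extW -> 'M[laurent]_n -> Prop :=
| ReducedTau j : reduced_value (tau ^+ j)%g (Mtau_exp j)
| ReducedRefl x m i of 0 < rootv x i & reduced_value x m :
    reduced_value (x * aff_refl i)%g (m *m M i).

Lemma reduced_value_ex x : exists m, reduced_value x m.
Proof.
have [k] := ubnPeq (len x); elim: k x => [|k IHk] x /eqP xk.
  by have [j ->] := len_eq0 xk; exists (Mtau_exp j); apply: ReducedTau.
have [i xi] : exists i, rootv x i < 0 by apply: has_descent; rewrite -len_dist xk.
have yi : 0 < rootv (x * aff_refl i)%g i by rewrite rootv_refl eqxx oppr_gt0.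
have [|m rm] := IHk (x * aff_refl i)%g; first by rewrite len_refl ltNge ltW // xk.
by exists (m *m M i); rewrite -(mulg_reflK x i); apply: ReducedRefl.
Qed.

Lemma Mtau_exp_mod3 j : Mtau_exp j = Mtau_exp (j %% 3).
Proof.
have E k l : Mtau_exp (k + 3 * l) = Mtau_exp k.
  elim: l => [|l IHl]; first by rewrite addn0.
  rewrite mulnS addnCA -[RHS]IHl /Mtau_exp !add3n ?addSn /=.
  by rewrite -[in LHS]mulmxA -[in LHS]mulmxA [Mt *m (_ *m _)]mulmxA Mtau3 mulmx1.
by rewrite {1}(divn_eq j 3) addnC mulnC E.
Qed.

Lemma reduced_value_inv x m : reduced_value x m ->
  (exists j, x = (tau ^+ j)%g /\ m = Mtau_exp j) \/
  exists y i p, [/\ x = (y * aff_refl i)%g, 0 < rootv y i, reduced_value y p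
    & m = p *m M i].
Proof. by case=> [j|y p i yi yp]; [left; exists j | right; exists y, i, p]. Qed.

(* Matsumoto's theorem: when two reduced expressions end in different         *)
(* reflections s_i and s_j, both s_i and s_j are right descents of x, hence   *)
(* so is every reflection of <s_i, s_j>, and x = u s_i s_j s_i reduced.       *)
Lemma reduced_value_fun x m m' : reduced_value x m -> reduced_value x m' -> m = m'.
Proof.
have [k] := ubnPeq (len x); elim/ltn_ind: k x m m' => k IHk x m m' /eqP xk.
move=> /reduced_value_inv[[j [xE ->]]|[y [i [p [xE yi yp ->]]]]];
move=> /reduced_value_inv[[j' [xE' ->]]|[y' [i' [p' [xE' yi' yp' ->]]]]].
- have : coset_rep x == coset_rep x by [].
  rewrite {1}xE xE' !coset_rep_tauX I3_natr_eq => /eqP e.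
  by rewrite Mtau_exp_mod3 e -Mtau_exp_mod3.
- by have := len_tauX j; rewrite -xE xE' len_refl yi'.
- by have := len_tauX j'; rewrite -xE' xE len_refl yi.
have yE : y = (x * aff_refl i)%g by rewrite xE mulg_reflK.
have yE' : y' = (x * aff_refl i')%g by rewrite xE' mulg_reflK.
have ly : (len y < k)%N by rewrite -xk xE len_refl yi.
have ly' : (len y' < k)%N by rewrite -xk xE' len_refl yi'.
have [ii|ii] := eqVneq i i'.
  by subst i'; congr (_ *m _); apply: (IHk _ ly y _ _ _ yp); rewrite // yE -yE'.
have xi : rootv x i < 0 by rewrite xE rootv_refl eqxx oppr_lt0.
have xi' : rootv x i' < 0 by rewrite xE' rootv_refl eqxx oppr_lt0.
(* When [a] and [b] are both descents, [u] is the shortest element of the coset of [x] by the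
   subgroup of s_a and s_b, and u s_a s_b is a second reduced expression of x s_a. *)
have step a b q : a != b -> rootv x a < 0 -> rootv x b < 0 ->
    reduced_value (x * (aff_refl a * aff_refl b * aff_refl a))%g q ->
    reduced_value (x * aff_refl a)%g (q *m M a *m M b).
  move=> ab xa xb uq; set u := (x * _)%g in uq.
  have ua : (u * aff_refl a)%g = (x * aff_refl a * aff_refl b)%g.
    by rewrite /u !mulgA mulg_reflK.
  have uab : (u * aff_refl a * aff_refl b)%g = (x * aff_refl a)%g.
    by rewrite ua mulg_reflK.
  rewrite -uab; apply: ReducedRefl.
    rewrite ua rootv_refl eqxx rootv_refl eq_sym (negPf ab); lia.
  apply: ReducedRefl uq; rewrite /u !mulgA !rootv_refl !eqxx (negPf ab) eq_sym (negPf ab).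
  lia.
have [q uq] := reduced_value_ex (x * (aff_refl i * aff_refl i' * aff_refl i))%g.
have yq := step _ _ _ ii xi xi' uq; rewrite -yE in yq.
rewrite (refl_braid ii) in uq; rewrite eq_sym in ii.
have yq' := step _ _ _ ii xi' xi uq; rewrite -yE' in yq'.
(* Both shorter elements are now expressed through the same matrix [q], so that only the braid
   relation of the matrices remains. *)
rewrite (IHk _ ly _ _ _ (introT eqP erefl) yp yq).
rewrite (IHk _ ly' _ _ _ (introT eqP erefl) yp' yq').
rewrite -!mulmxA; congr (_ *m _); rewrite !mulmxA; exact/esym/Mbraid.
Qed.

Lemma reduced_value_tau x m : reduced_value x m -> reduced_value (x * tau)%g (m *m Mt).
Proof.
elim=> [j|y p i yi yp IHy].
  by rewrite -expgSr; apply: (ReducedTau j.+1).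
have iE : i = (i - 1) + 1 by rewrite subrK.
have -> : (y * aff_refl i * tau)%g = (y * tau * aff_refl (i - 1))%g.
  by rewrite -[LHS]mulgA {1}iE -tau_refl mulgKV [LHS]mulgA.
rewrite -mulmxA {2}iE -Mtau mulmxA.
by apply: ReducedRefl => //; rewrite rootv_tau -iE.
Qed.

Variables (H : algType laurent) (T : extW -> H) (HT : is_hecke_algebra T).

(** Right multiplication by T_s is checked on the basis: an ascent follows from the functionality of
    [reduced_value], and a descent is an ascent read backwards with the quadratic relation. *)
Theorem hecke_representation : exists rho : {linear H -> 'M[laurent]_n},
  (forall x, reduced_value x (rho (T x))) /\
  (forall a b, rho (a * b) = rho a *m rho b).
Proof.
have /choice[m mP] := reduced_value_ex.
have [rho rhoE] := hecke_lift HT m.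
have rhoP x : reduced_value x (rho (T x)) by rewrite rhoE.
have rho_refl h i : rho (h * T (aff_refl i)) = rho h *m M i.
  elim/(hecke_ind HT): h => [a h k hE kE||x].
  - by rewrite mulrDl -scalerAl !linearP hE kE mulmxDl scalemxAl.
  - by rewrite mul0r !linear0 mul0mx.
  have up y : 0 < rootv y i -> rho (T (y * aff_refl i)%g) = rho (T y) *m M i.
    by move=> yi; apply: reduced_value_fun (rhoP _) (ReducedRefl yi (rhoP y)).
  have [xi|xi] := ltP 0 (rootv x i); first by rewrite (hecke_refl HT) ?up.
  have {}xi : rootv x i < 0 by rewrite lt_neqAle rootv_neq0.
  have /up e : 0 < rootv (x * aff_refl i)%g i by rewrite rootv_refl eqxx oppr_gt0.
  rewrite mulg_reflK in e.
  by rewrite (hecke_refl_down HT) // linearD linearZ /= e -mulmxA Mquad mulmxDr mulmx1 -scalemxAr.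
have rho_tau h j : rho (h * T (tau ^+ j)%g) = rho h *m Mtau_exp j.
  elim/(hecke_ind HT): h => [a h k hE kE||x].
  - by rewrite mulrDl -scalerAl !linearP hE kE mulmxDl scalemxAl.
  - by rewrite mul0r !linear0 mul0mx.
  rewrite (hecke_tau HT); elim: j => [|j IHj]; first by rewrite mulg1 mulmx1.
  rewrite expgSr mulgA (reduced_value_fun (rhoP _) (reduced_value_tau (rhoP _))) IHj.
  by rewrite -mulmxA.
exists rho; split=> // a b.
elim/(hecke_ind HT): b => [c h k hE kE||x].
- by rewrite mulrDr -scalerAr !linearP hE kE.
- by rewrite mulr0 !linear0.
elim: (rhoP x) => [j|y p i yi yp IHy]; first by rewrite rho_tau.
by rewrite -(hecke_refl HT) // mulrA rho_refl IHy mulmxA.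
Qed.
End Representation.

(** * Specialisation at v = 1 *)

Lemma laurent_fracP (f : laurent) : exists pn : {poly int} * nat,
  val f = tofrac pn.1 / tofrac 'X ^+ pn.2.
Proof. by have /asboolP[p [n ->]] := valP f; exists (p, n). Qed.

Definition laurent_frac (f : laurent) := sval (cid (laurent_fracP f)).

Definition eval1 (f : laurent) : int := (laurent_frac f).1.[1].

(** Powers of v are 1 at v = 1, so cross-multiplying two presentations of [f] gives the same value
    of the numerators. *)
Lemma eval1E (f : laurent) p n : val f = tofrac p / tofrac 'X ^+ n -> eval1 f = p.[1].
Proof.
rewrite /eval1 /laurent_frac; have := svalP (cid (laurent_fracP f)).
move: (sval _) => [q m] /= -> /eqP.
rewrite eqr_div ?expf_neq0 ?X_frac_neq0 // -!tofracXn -!tofracM tofrac_eq => /eqP.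
by move/(congr1 (horner^~ 1)); rewrite /= !hornerM !hornerXn !expr1n !mulr1.
Qed.

Lemma eval1B : zmod_morphism eval1.
Proof.
move=> f g; have [[p m] /= fE] := laurent_fracP f; have [[q n] /= gE] := laurent_fracP g.
rewrite (eval1E fE) (eval1E gE).
rewrite (@eval1E _ (p * 'X^n - q * 'X^m) (m + n)%N).
  by rewrite hornerD hornerN !hornerM !hornerXn !expr1n !mulr1.
rewrite rmorphB /= [laurent_val f]fE [laurent_val g]gE tofracB !tofracM !tofracXn exprD -mulNr.
by rewrite addf_div ?expf_neq0 ?X_frac_neq0 // mulNr.
Qed.

Lemma eval1M : monoid_morphism eval1.
Proof.
split=> [|f g].
  by rewrite (@eval1E _ 1 0) ?hornerC //= tofrac1 expr0 divr1.
have [[p m] /= fE] := laurent_fracP f; have [[q n] /= gE] := laurent_fracP g.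
rewrite (eval1E fE) (eval1E gE) (@eval1E _ (p * q) (m + n)%N) ?hornerM //.
by rewrite rmorphM /= [laurent_val f]fE [laurent_val g]gE tofracM exprD invfM mulrACA.
Qed.

HB.instance Definition _ := GRing.isZmodMorphism.Build laurent int eval1 eval1B.
HB.instance Definition _ := GRing.isMonoidMorphism.Build laurent int eval1 eval1M.

Lemma eval1_v : eval1 v = 1.
Proof. by rewrite (@eval1E _ 'X 0) ?hornerX //= expr0 divr1. Qed.

Lemma eval1_vinv : eval1 vinv = 1.
Proof. by rewrite (@eval1E _ 1 1) ?hornerC //= tofrac1 expr1 div1r. Qed.

Lemma eval1_zz : eval1 zz = 0.
Proof. by rewrite rmorphB /= eval1_v eval1_vinv subrr. Qed.

Lemma v_sqr : v * v = 1 + zz * v.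
Proof. by rewrite /zz mulrBl [vinv * v]mulrC v_vinv addrC subrK. Qed.

Lemma laurent_polyP (p : {poly int}) n : tofrac p / tofrac 'X ^+ n \in laurent_pred.
Proof. by apply/asboolP; exists p, n. Qed.

Lemma subv1_reg (f g : laurent) : (v - 1) * f = (v - 1) * g -> f = g.
Proof.
move/(congr1 val); rewrite !rmorphM => e; apply: val_inj; apply: mulfI e.
rewrite rmorphB rmorph1 /= -tofrac1 -tofracB tofrac_eq0.
by rewrite -size_poly_eq0 size_XsubC.
Qed.

(* Allows to specialise linear relations at v = 1: the coefficients that      *)
(* vanish there are divided by v - 1 until one of them does not.              *)
Lemma laurent_family_eq0 (I : eqType) (s : seq I) (P : (I -> laurent) -> Prop) :
    (forall c, P c -> forall i, i \in s -> eval1 (c i) = 0) ->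
    (forall c d, (forall i, i \in s -> c i = (v - 1) * d i) -> P c -> P d) ->
  forall c, P c -> forall i, i \in s -> c i = 0.
Proof.
move=> P1 Pdiv c Pc.
have /choice[pn pnE] i := laurent_fracP (c i).
(* The induction is on a bound for the sizes of the numerators, which drops at each division by v -
   1; bound 0 means that all coefficients vanish. *)
pose d := \max_(i <- s) size (pn i).1.
have dP i : i \in s -> (size (pn i).1 <= d)%N by move=> si; apply: leq_bigmax_seq.
move: d dP => d; elim: d c Pc pn pnE => [|d IHd] c Pc pn pnE dP i si.
  by apply: val_inj; rewrite pnE; have := dP _ si; rewrite leqn0 size_poly_eq0 => /eqP ->;
    rewrite tofrac0 mul0r.
have /choice[q qE] j : exists q, j \in s -> (pn j).1 = q * ('X - 1%:P).
  have [sj|] := boolP (j \in s); last by exists 0.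
  have /eqP := P1 _ Pc _ sj; rewrite (eval1E (pnE j)) => /factor_theorem[q ->].
  by exists q.
pose c' j := Laurent (laurent_polyP (q j) (pn j).2).
have cE j : j \in s -> c j = (v - 1) * c' j.
  move=> sj; apply: val_inj; rewrite pnE rmorphM rmorphB rmorph1 /= qE // tofracM tofracB.
  by rewrite tofrac1 mulrAC mulrC mulrA.
rewrite cE // (IHd c' _ (fun j => (q j, (pn j).2))) ?mulr0 //.
  exact: Pdiv Pc.
move=> j sj /=; have [-> |q0] := eqVneq (q j) 0; first by rewrite size_poly0.
have := dP _ sj; rewrite qE // size_Mmonic ?monicXsubC // size_XsubC addn2.
by [].
Qed.

(** * Representations on weighted permutation sets *)

Lemma I3_pred : (((0 - 1)%R = 2%R :> 'I_3) * ((1 - 1)%R = 0%R :> 'I_3)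
  * ((2 - 1)%R = 1%R :> 'I_3))%type.
Proof. by split; first split; apply: val_inj. Qed.

Lemma linpart_refl_inv i j :
  (linpart (aff_refl i))^-1%g j = if j == i then i - 1 else if j == i - 1 then i else j.
Proof.
move: i j; elim/I3P; elim/I3P; rewrite ?aff_refl0 ?aff_refl1 ?aff_refl2 ?s0E /=;
  rewrite ?permE3; by apply: val_inj.
Qed.

Lemma linpart_tau_inv j : (linpart tau)^-1%g j = j + 1.
Proof. by rewrite tauE; elim/I3P: j; rewrite /= ?permE3; apply: val_inj. Qed.

Section WeightedSet.
Variables (X : finType) (act : X -> extW -> X) (g : X -> 'I_3 -> int).
Variable shift : X -> X.
Hypothesis act1 : forall a, act a 1%g = a.
Hypothesis actM : forall a x y, act a (x * y)%g = act (act a x) y.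
Hypothesis g_act : forall a x j, g (act a x) j = g a ((linpart x)^-1%g j).
Hypothesis g_fix : forall a i, g a i = g a (i - 1) -> act a (aff_refl i) = a.
Hypothesis shift_act : forall a x, shift (act a x) = act (shift a) x.
Hypothesis g_shift : forall a, g (shift a) = g a.

Let n := #|X|.

(** Value of the linear part of the i-th simple affine root: unlike [rootv], the three slopes sum to
    0, and [slope_refl] is the analogue of [rootv_refl]. *)
Definition slope a i : int := g a i - g a (i - 1).

Lemma slope_refl a i j : slope (act a (aff_refl i)) j =
  if j == i then - slope a i else slope a j + slope a i.
Proof.
rewrite /slope !g_act !linpart_refl_inv.
move: i j; elim/I3P; elim/I3P; rewrite ?I3_pred /=; ring.
Qed.

Lemma slope_tau a i : slope (act a tau) i = slope a (i + 1).
Proof. by rewrite /slope !g_act !linpart_tau_inv subrK addrK. Qed.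

Lemma slope_shift a i : slope (shift a) i = slope a i.
Proof. by rewrite /slope g_shift. Qed.

(* The action of T_{s_i} in the representation induced from the parabolic     *)
(* subalgebra of the walls of slope 0, on which its reflections act by v; the *)
(* sign of the slope orients the other walls.                                 *)
Definition refl_op (i : 'I_3) (F : X -> laurent) (a : X) : laurent :=
  if slope a i == 0 then v * F a
  else if 0 < slope a i then F (act a (aff_refl i))
  else F (act a (aff_refl i)) + zz * F a.

Definition ptmx (s : X -> X) : 'M[laurent]_n :=
  \matrix_(a, b) (enum_val b == s (enum_val a))%:R.

Definition refl_mx (i : 'I_3) : 'M[laurent]_n :=
  \matrix_(a, b) refl_op i (fun c => (enum_val b == c)%:R) (enum_val a).

Lemma matrix_enumP (A B : 'M[laurent]_n) :
  (forall a k, A (enum_rank a) k = B (enum_rank a) k) -> A = B.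
Proof. by move=> AB; apply/matrixP => i k; rewrite -(enum_valK i) AB. Qed.

Lemma sum_enum_rank (R : pzSemiRingType) (F : 'I_n -> R) b :
  \sum_c (enum_val c == b)%:R * F c = F (enum_rank b).
Proof.
rewrite (bigD1 (enum_rank b)) //= enum_rankK eqxx mul1r big1 ?addr0 // => c.
by rewrite -(inj_eq enum_val_inj) enum_rankK => /negPf ->; rewrite mul0r.
Qed.

Lemma mul_ptmx s (N : 'M[laurent]_n) a k : (ptmx s *m N) (enum_rank a) k = N (enum_rank (s a)) k.
Proof.
rewrite mxE -[RHS](sum_enum_rank (N^~ k)); apply: eq_bigr => c _.
by rewrite mxE enum_rankK.
Qed.

(** Each column of [N] is a function on [X]; matrix identities are thereby reduced to pointwise
    identities for [refl_op]. *)
Lemma mul_refl_mx i (N : 'M[laurent]_n) a k :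
  (refl_mx i *m N) (enum_rank a) k = refl_op i (fun b => N (enum_rank b) k) a.
Proof.
rewrite mxE (eq_bigr (fun c => refl_op i (fun b => (enum_val c == b)%:R) a * N c k)); last first.
  by move=> c _; rewrite mxE enum_rankK.
rewrite /refl_op; case: ifP => _.
  under eq_bigr do rewrite -mulrA.
  by rewrite -mulr_sumr (sum_enum_rank (N^~ k)).
case: ifP => _; first by rewrite (sum_enum_rank (N^~ k)).
under eq_bigr do rewrite mulrDl -mulrA.
by rewrite big_split -mulr_sumr /= !(sum_enum_rank (N^~ k)).
Qed.

Lemma slope_fix a i : slope a i = 0 -> act a (aff_refl i) = a.
Proof. by move/subr0_eq/g_fix. Qed.

Lemma refl_op_sqr i F a : refl_op i (refl_op i F) a = F a + zz * refl_op i F a.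
Proof.
rewrite /refl_op slope_refl eqxx oppr_eq0 oppr_gt0 -actM aff_reflK act1.
case: ltgtP => // _.
by rewrite !mulrA v_sqr mulrDl mul1r.
Qed.

(** The signs of the two slopes and of their sum decide every branch on both sides, and a zero slope
    makes the reflection fix the point. Each consistent sign pattern leaves a polynomial identity,
    modulo v^2 = 1 + zz v. *)
Lemma refl_op_braid i j F a : i != j ->
  refl_op i (refl_op j (refl_op i F)) a = refl_op j (refl_op i (refl_op j F)) a.
Proof.
move=> ij; have ji := ij; rewrite eq_sym in ji.
set si := aff_refl i; set sj := aff_refl j.
have br : act (act (act a si) sj) si = act (act (act a sj) si) sj.
  by have /(congr1 (act a)) := refl_braid ij; rewrite !actM.
have fi b : slope b i = 0 -> act b si = b by apply: slope_fix.
have fj b : slope b j = 0 -> act b sj = b by apply: slope_fix.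
have di : slope (act (act a si) sj) i = slope a j.
  by rewrite !slope_refl !eqxx (negPf ij) (negPf ji) /=; lia.
have dj : slope (act (act a sj) si) j = slope a i.
  by rewrite !slope_refl !eqxx (negPf ij) (negPf ji) /=; lia.
have ei : slope (act a sj) i = slope a i + slope a j.
  by rewrite slope_refl (negPf ij).
have ej : slope (act a si) j = slope a i + slope a j.
  by rewrite slope_refl (negPf ji) addrC.
have oi : slope (act a si) i = - slope a i by rewrite slope_refl eqxx.
have oj : slope (act a sj) j = - slope a j by rewrite slope_refl eqxx.
have := (fi a, fj a, fj (act a si), fi (act a sj),
         fi (act (act a si) sj), fj (act (act a sj) si)).
rewrite /refl_op -/si -/sj di dj ei ej oi oj !oppr_eq0 !oppr_gt0 br.
move=> {fi fj di dj ei ej oi oj}.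
move: (slope a i) (slope a j) => b c [[[[[fi fj] fij] fji] fiji] fjij].
have vz : v * v = 1 + zz * v := v_sqr.
have [aii ajj] : act (act a si) si = a /\ act (act a sj) sj = a.
  by rewrite -!actM !aff_reflK act1.
case: (ltgtP b 0) fi fjij => [hb _ _|hb _ _|hb /(_ hb) fi /(_ hb) fjij];
case: (ltgtP c 0) fj fiji => [hc _ _|hc _ _|hc /(_ hc) fj /(_ hc) fiji];
case: (ltgtP (b + c) 0) fij fji => [hd _ _|hd _ _|hd /(_ hd) fij /(_ hd) fji]; try lia.
all: rewrite ?fi ?fj ?fij ?fji ?fiji ?fjij ?aii ?ajj.
all: try ring. all: try (ring: vz).
Qed.

Let Mt : 'M[laurent]_n := ptmx (act^~ tau).

Lemma refl_op_ext i a F G : F =1 G -> refl_op i F a = refl_op i G a.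
Proof. by move=> /funext ->. Qed.

Lemma refl_mx_quad i : refl_mx i *m refl_mx i = 1%:M + zz *: refl_mx i.
Proof.
apply: matrix_enumP => a k; rewrite mul_refl_mx.
have E b : refl_mx i (enum_rank b) k = refl_op i (fun c => (enum_val k == c)%:R) b.
  by rewrite mxE enum_rankK.
rewrite (refl_op_ext i a E) refl_op_sqr -E [in RHS]mxE [X in _ = X + _]mxE [X in _ = _ + X]mxE.
by rewrite -(inj_eq enum_val_inj) enum_rankK eq_sym.
Qed.

Lemma refl_mx_braid i j : i != j ->
  refl_mx i *m refl_mx j *m refl_mx i = refl_mx j *m refl_mx i *m refl_mx j.
Proof.
move=> ij; rewrite -[LHS]mulmx1 -[RHS]mulmx1 -!mulmxA.
apply: matrix_enumP => a k; rewrite !mul_refl_mx.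
transitivity (refl_op i (refl_op j (refl_op i (fun b => 1%:M (enum_rank b) k))) a).
  by apply: refl_op_ext => b; rewrite mul_refl_mx; apply: refl_op_ext => c; rewrite mul_refl_mx.
rewrite refl_op_braid //.
by apply: refl_op_ext => b; rewrite mul_refl_mx; apply: refl_op_ext => c; rewrite mul_refl_mx.
Qed.

Lemma refl_mx_tau i : Mt *m refl_mx i = refl_mx (i + 1) *m Mt.
Proof.
rewrite -[LHS]mulmx1 -mulmxA; apply: matrix_enumP => a k.
have E b : Mt (enum_rank b) k = 1%:M (enum_rank (act b tau)) k.
  by rewrite -[Mt]mulmx1 mul_ptmx.
have actE : act (act a (aff_refl (i + 1))) tau = act (act a tau) (aff_refl i).
  by rewrite -!actM -tau_refl mulgKV.
by rewrite mul_ptmx !mul_refl_mx /refl_op slope_tau !E actE.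
Qed.

Lemma tau_mx3 : Mt *m Mt *m Mt = 1%:M.
Proof.
rewrite -[LHS]mulmx1 -!mulmxA; apply: matrix_enumP => a k.
by rewrite !mul_ptmx -!actM; congr (1%:M (enum_rank _) _); rewrite -[RHS]act1 -tau3.
Qed.

Lemma shift_mx_refl i : refl_mx i *m ptmx shift = ptmx shift *m refl_mx i.
Proof.
rewrite -[LHS]mulmx1 -[RHS]mulmx1 -!mulmxA; apply: matrix_enumP => a k.
rewrite mul_ptmx !mul_refl_mx /refl_op slope_shift -shift_act.
by rewrite !mul_ptmx.
Qed.

Lemma shift_mx_tau : Mt *m ptmx shift = ptmx shift *m Mt.
Proof.
rewrite -[LHS]mulmx1 -[RHS]mulmx1 -!mulmxA; apply: matrix_enumP => a k.
by rewrite !mul_ptmx shift_act.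
Qed.

Lemma shift_mx_value x m : reduced_value refl_mx Mt x m ->
  m *m ptmx shift = ptmx shift *m m.
Proof.
elim=> [j|y p i yi yp IHy]; last first.
  by rewrite -mulmxA shift_mx_refl !mulmxA IHy.
elim: j => [|j IHj]; first by rewrite /Mtau_exp /= mulmx1 mul1mx.
by rewrite /Mtau_exp /= -mulmxA shift_mx_tau !mulmxA IHj.
Qed.

(** At v = 1 the terms in [zz] disappear, and multiplication by v on a wall of slope 0 agrees with
    the permutation because the reflection fixes that point. *)
Lemma eval1_value x m a b : reduced_value refl_mx Mt x m ->
  eval1 (m (enum_rank a) (enum_rank b)) = (b == act a x)%:R.
Proof.
move=> xm; elim: xm a b => [j|y p i yi yp IHy] a b.
  elim: j a => [|j IHj] a.
    by rewrite /Mtau_exp /= mxE act1 (inj_eq enum_rank_inj) rmorph_nat eq_sym.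
  have -> : Mtau_exp Mt j.+1 = Mt *m Mtau_exp Mt j.
    elim: j {IHj} => [|j]; first by rewrite /Mtau_exp /= mulmx1 mul1mx.
    by rewrite /Mtau_exp /= mulmxA => <-.
  by rewrite mul_ptmx IHj -actM -expgS.
rewrite mxE rmorph_sum /=.
transitivity (\sum_c (enum_val c == act a y)%:R * eval1 (refl_mx i c (enum_rank b))).
  by apply: eq_bigr => c _; rewrite rmorphM /= -IHy enum_valK.
rewrite (sum_enum_rank (fun c => eval1 (refl_mx i c (enum_rank b)))) mxE !enum_rankK.
rewrite /refl_op actM; case: eqP => [/slope_fix ->|_].
  by rewrite rmorphM /= eval1_v mul1r rmorph_nat.
case: ifP => _; first by rewrite rmorph_nat.
by rewrite rmorphD rmorphM /= eval1_zz mul0r addr0 rmorph_nat.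
Qed.

Variables (H : algType laurent) (T : extW -> H) (HT : is_hecke_algebra T).

(** The shift commutes with the whole representation, so inserting its matrix preserves the symmetry
    of the trace. *)
Theorem weighted_trace : exists F : {linear H -> laurent^o},
  (forall a b, F (a * b) = F (b * a)) /\
  (forall x, eval1 (F (T x)) = #|[pred a | shift (act a x) == a]|%:R).
Proof.
have [rho [rhoV rhoM]] := hecke_representation refl_mx_quad refl_mx_braid refl_mx_tau tau_mx3 HT.
pose F h : laurent^o := \tr (rho h *m ptmx shift).
have linF : linear F by move=> a h k; rewrite /F linearP mulmxDl -scalemxAl linearP.
pose L := GRing.isLinear.Build laurent H laurent^o *:%R F linF.
pose r : {linear H -> laurent^o} := HB.pack F L.
have shiftC h : rho h *m ptmx shift = ptmx shift *m rho h.
  elim/(hecke_ind HT): h => [a h k hE kE||x]; last exact: shift_mx_value (rhoV x).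
    by rewrite linearP mulmxDl mulmxDr -scalemxAl -scalemxAr hE kE.
  by rewrite linear0 mul0mx mulmx0.
exists r; split=> [a b|x].
  rewrite -[LHS]/(F (a * b)) -[RHS]/(F (b * a)) /F !rhoM -!mulmxA (shiftC b) mxtrace_mulC.
  by rewrite [in RHS]mulmxA [RHS]mxtrace_mulC mulmxA.
rewrite -[r _]/(F (T x)) /F /mxtrace rmorph_sum /=.
rewrite -sum1_card natr_sum [RHS]big_mkcond /= (reindex enum_rank) /=; last first.
  by exists enum_val => a _; rewrite ?enum_rankK ?enum_valK.
apply: eq_bigr => a _; rewrite shiftC mul_ptmx (eval1_value _ _ (rhoV x)) inE.
by rewrite -shift_act eq_sym; case: (_ == _).
Qed.
End WeightedSet.

(** * Independence of the classes in the cocenter *)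

Lemma conj_classP x y : conj_class x y <-> exists g, (g * x = y * g)%g.
Proof.
split=> [[g _ <-]|[g e]]; first by exists g; rewrite mulgKV.
by exists g => //; rewrite e mulgK.
Qed.

Lemma conj_class_refl x : conj_class x x.
Proof. by apply/conj_classP; exists 1%g; rewrite mul1g mulg1. Qed.

Lemma conj_class_sym x y : conj_class x y -> conj_class y x.
Proof.
move=> /conj_classP[g e]; apply/conj_classP; exists g^-1%g.
by apply: (mulgI g); rewrite !mulgA mulgV mul1g e mulgK.
Qed.

Lemma conj_class_trans x y u : conj_class x y -> conj_class y u -> conj_class x u.
Proof.
move=> /conj_classP[g e] /conj_classP[h f]; apply/conj_classP; exists (h * g)%g.
by rewrite -mulgA e mulgA f mulgA.
Qed.

Lemma conj_class_eq x y : conj_class x y -> conj_class x = conj_class y.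
Proof.
move=> xy; apply/seteqP; split=> u; last exact: conj_class_trans.
by apply: conj_class_trans; apply: conj_class_sym.
Qed.

Lemma extW_trans_mul w y : (ExtW 0 w * t y)%g = (t (weyl_act w y) * ExtW 0 w)%g.
Proof. by rewrite !extW_mulE /= weyl_act0 add0r addr0 mulg1 mul1g. Qed.

(* For [k] fixed by the linear part of [x], the coordinate of the translation *)
(* part of [x] along the axis of the glide reflection [x].                    *)
Definition glide (x : extW) (k : 'I_3) : int :=
  (transl x).1 + 2 * (transl x).2 - 3 * lift3 (transl x) k.

(** [glide] is the sum of the three lifted coordinates minus 3 times the k-th one. This cocycle
    identity makes [glide_act] an action and the glide at a fixed index a conjugacy invariant. *)
Lemma glideM x y k : glide (x * y)%g k = glide x k + glide y (linpart x k).
Proof.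
rewrite /glide extW_mulE /= mulrDr addrACA weyl_act_sum lift3D lift3_act; ring.
Qed.

Lemma glide1 k : glide 1%g k = 0.
Proof. by rewrite /glide /= lift30. Qed.

Lemma linpartM x y k : linpart (x * y)%g k = linpart y (linpart x k).
Proof. by rewrite extW_mulE /= permM. Qed.

Definition glide_refl (m : int) : set extW :=
  [set x | linpart x != 1%g /\ exists k, linpart x k = k /\ glide x k = m].

Lemma conj_class_glide m : conj_class (ExtW (m, 0) r1) = glide_refl m.
Proof.
apply/seteqP; split=> x.
  move=> /conj_classP[g e]; split.
    have /(congr1 linpart) := e; rewrite !extW_mulE /= => e'.
    apply/eqP => x1; move: e'; rewrite x1 mul1g => /(canRL (mulKg _)).
    by rewrite mulVg => /permP /(_ 0); rewrite !permE3.
  have xE : x = (g * ExtW (m, 0) r1 * g^-1)%g by rewrite e mulgK.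
  have g2 : linpart g (linpart g^-1%g 2) = 2 by rewrite -linpartM mulVg /= perm1.
  exists (linpart g^-1%g 2); split; first by rewrite xE !linpartM g2 /= r1E.
  rewrite xE !glideM linpartM g2 /= r1E.
  have := glide1 (linpart g^-1%g 2); rewrite -(mulgV g) glideM g2.
  by rewrite /glide /lift3 /=; lia.
case: x => [[a b] w] /= [w1 [k [wk <-]]]; apply/conj_class_sym/conj_classP.
move: w k w1 wk; elim/S3P; elim/I3P; rewrite ?permE3 // ?eqxx // => _ _; rewrite /glide /lift3 /=.
- exists (t (b, 0)); apply: extW_ext; rewrite /= ?permE3 //.
  rewrite /weyl_act ?permE3 /lift3 /=; congr pair => /=; lia.
- exists (ExtW (- a - b, 0) (r2 * r1)%g); apply: extW_ext; rewrite /= ?permE3 //.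
  rewrite /weyl_act ?permE3 /lift3 /=; congr pair => /=; lia.
- exists (ExtW (- b, 0) r2); apply: extW_ext; rewrite /= ?permE3 //.
  rewrite /weyl_act ?permE3 /lift3 /=; congr pair => /=; lia.
Qed.

Definition rotation_type : set extW := [set x | forall k, linpart x k != k].

Lemma Zp_intr_eq0 N (m : int) : (m%:~R == 0 :> 'I_N.+2) = (N.+2 %| m)%Z.
Proof.
have natP (k : nat) : (k%:R == 0 :> 'I_N.+2) = (N.+2 %| k)%N.
  by rewrite -val_eqE /= Zp_nat.
case: m => k; first by rewrite natP.
by rewrite NegzE mulrNz oppr_eq0 natP.
Qed.

Lemma I3_intr_eq (p q : int) : (p%:~R == q%:~R :> 'I_3) = ((p - q) %% 3 == 0)%Z.
Proof. by rewrite -subr_eq0 -mulrzBr Zp_intr_eq0; apply/dvdz_mod0P/eqP. Qed.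

(** For a rotation w, the image of P under 1 - w is Q, so conjugation by translations leaves only
    the coset modulo Q; r1 exchanges the two rotations. *)
Lemma conj_class_rotation x y : rotation_type x -> rotation_type y ->
  coset_rep x = coset_rep y -> conj_class x y.
Proof.
have nf z : rotation_type z ->
    conj_class z (ExtW (((transl z).1 + 2 * (transl z).2) %% 3, 0)%Z (r1 * r2)%g).
  case: z => [[a b] w] zr; apply/conj_classP.
  have := (zr 0, zr 1, zr 2); rewrite /=.
  elim/S3P: w {zr}; rewrite !permE3 ?eqxx => -[[z0 z1] z2] //.
  - exists (t (- ((a - b) %/ 3)%Z, - ((a - b) %/ 3)%Z - b)); apply: extW_ext; rewrite /= ?permE3 //.
    rewrite /weyl_act ?permE3 /lift3 /=; congr pair => /=; lia.
  - exists (ExtW (- ((- a - a - b) %/ 3)%Z, - ((- a - a - b) %/ 3)%Z - (a + b)) r1).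
    apply: extW_ext; rewrite /= ?permE3 //.
    rewrite /weyl_act ?permE3 /lift3 /=; congr pair => /=; lia.
move=> xr yr /eqP; rewrite /coset_rep I3_intr_eq => /eqP e.
apply: conj_class_trans (nf _ xr) _; apply: conj_class_sym.
have -> : ((((transl x).1 + 2 * (transl x).2) %% 3)
  = (((transl y).1 + 2 * (transl y).2) %% 3))%Z by move: e; lia.
exact: nf.
Qed.

(** A modulus larger than all the listed integers: congruences between the finitely many data of a
    relation become equalities. *)
Lemma Zp_intr_inj (s : seq int) :
  exists N, forall m, m \in s -> m%:~R = 0 :> 'I_N.+2 -> m = 0.
Proof.
exists (\sum_(m <- s) `|m|)%N => m ms /eqP; rewrite Zp_intr_eq0 => /dvdzP[q mq].
have : (`|m| < (\sum_(i <- s) `|i|).+2)%N.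
  by rewrite (big_rem m) //=; lia.
rewrite {1}mq abszM /=; case: q mq => [[|q]|q] -> //; nia.
Qed.

Section TranslationSet.
Variables (N : nat) (mu : coweight).
Let L := 'I_N.+2.

Definition modN (x : coweight) : L * L := (x.1%:~R, x.2%:~R).

(** Right multiplication in the extended group, with translations reduced modulo [N.+2];
    [transl_shift] is left multiplication by t^(-mu), hence commutes with it. A point is fixed by
    their composite only if [y] is a translation conjugate to t^mu modulo [N.+2]. *)
Definition transl_act (a : L * L * 'S_3) (y : extW) : L * L * 'S_3 :=
  (a.1 + modN (weyl_act a.2 (transl y)), (a.2 * linpart y)%g).

Definition transl_shift (a : L * L * 'S_3) : L * L * 'S_3 := (a.1 - modN mu, a.2).

Definition transl_count (x : extW) : nat :=
  #|[pred a | transl_shift (transl_act a x) == a]|.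

Lemma modND x y : modN (x + y) = modN x + modN y.
Proof. by rewrite /modN /= !mulrzDr. Qed.
End TranslationSet.

Section GlideSet.
Variables (N : nat) (m : int).
Let L := 'I_N.+2.

(** With the shift by -m, a fixed point is an index [k] fixed by the linear part of [y] at which the
    glide of [y] is m modulo [N.+2]. *)
Definition glide_act (a : L * 'I_3) (y : extW) : L * 'I_3 :=
  (a.1 + (glide y a.2)%:~R, linpart y a.2).

Definition glide_shift (a : L * 'I_3) : L * 'I_3 := (a.1 - m%:~R, a.2).

Definition glide_count (x : extW) : nat :=
  #|[pred a | glide_shift (glide_act a x) == a]|.
End GlideSet.

Definition coset_count (c : 'I_3) (x : extW) : nat :=
  #|[pred a | a + coset_rep x - c == a]|.

Section Independence.
Variables (H : algType laurent) (T : extW -> H) (HT : is_hecke_algebra T).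

Definition has_trace (chi : extW -> nat) : Prop :=
  exists F : {linear H -> laurent^o}, (forall a b, F (a * b) = F (b * a)) /\
  (forall x, eval1 (F (T x)) = (chi x)%:R).

Lemma transl_trace N mu : has_trace (@transl_count N mu).
Proof.
pose g (a : 'I_N.+2 * 'I_N.+2 * 'S_3) (j : 'I_3) : int := ((a.2)^-1%g j : nat)%:Z.
apply: (@weighted_trace _ (@transl_act N) g (@transl_shift N mu)) HT.
(* These weights are pairwise distinct, so no slope vanishes: the inducing parabolic is trivial. *)
- by case=> p w; rewrite /transl_act /= weyl_act0 mulg1; congr pair; apply: addr0.
- case=> p w x y; rewrite /transl_act extW_mulE /= weyl_actD weyl_actM modND addrA mulgA.
  by [].
- by case=> p w x j; rewrite /g /= invMg permM.
- move=> a i [] /val_inj /perm_inj /eqP; rewrite -subr_eq0 opprB addrC subrK.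
  by rewrite (_ : 1 == 0 :> 'I_3 = false).
- by case=> p w x; rewrite /transl_shift /transl_act /= addrAC.
- by [].
Qed.

Lemma glide_trace N m : has_trace (@glide_count N m).
Proof.
(* The slope of s_i vanishes exactly when the index is neither i nor i - 1, that is, when s_i fixes
   it; the glide of s_i is then 0. *)
pose g (a : 'I_N.+2 * 'I_3) (j : 'I_3) : int := (j == a.2 : nat)%:Z.
apply: (@weighted_trace _ (@glide_act N) g (@glide_shift N m)) HT.
- by case=> p k; rewrite /glide_act /= glide1 perm1 addr0.
- by case=> p k x y; rewrite /glide_act /= glideM permM mulrzDr addrA.
- by case=> p k x j; rewrite /g /= (canF_eq (permKV _)).
- case=> p k i; rewrite /g /glide_act /=.
  move: k i; elim/I3P; elim/I3P => //= _; rewrite ?aff_refl0 ?aff_refl1 ?aff_refl2 ?s0E /=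
    ?permE3 /glide /lift3 /=; by congr pair; rewrite -[RHS]addr0; congr (_ + _); apply: val_inj.
- by case=> p k x; rewrite /glide_shift /glide_act /= addrAC.
- by [].
Qed.

(** With zero weights every T_s acts by v and only the class in P / Q is seen; rotations are
    classified by it. *)
Lemma coset_trace c : has_trace (coset_count c).
Proof.
pose act a x := a + coset_rep x.
apply: (@weighted_trace _ act (fun _ _ => 0) (fun a => a - c)) HT.
- by move=> a; rewrite /act (coset_rep_tauX 0) addr0.
- by move=> a x y; rewrite /act coset_repM addrA.
- by [].
- move=> a i _; rewrite /act -[RHS]addr0; congr (_ + _).
  by elim/I3P: i; rewrite ?aff_refl0 ?aff_refl1 ?aff_refl2 ?s0E; apply: val_inj.
- by move=> a x; rewrite /act addrAC.
- by [].
Qed.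

Lemma commutator_trace (F : {linear H -> laurent^o}) h :
  (forall a b, F (a * b) = F (b * a)) -> commutator_span h -> F h = 0.
Proof.
move=> Ftr [s [c ->]]; rewrite linear_sum big1 // => p _.
by rewrite linearZ linearB /= Ftr subrr scaler0.
Qed.

(* At v = 1, the characters of the three families of representations are      *)
(* triangular for the order translations < glide reflections < rotations.     *)
Theorem class_independence (s : seq extW) (c : extW -> laurent) :
  uniq s -> (forall x y, x \in s -> y \in s -> conj_class x y -> x = y) ->
  commutator_span (\sum_(x <- s) c x *: T x) -> forall x, x \in s -> c x = 0.
Proof.
move=> us s_conj sc.
pose P c := forall F : {linear H -> laurent^o}, (forall a b, F (a * b) = F (b * a)) ->
  \sum_(x <- s) c x * F (T x) = 0.
have Pc : P c.
  move=> F Ftr; have := commutator_trace Ftr sc; rewrite linear_sum => e.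
  by rewrite -[RHS]e; apply: eq_bigr => x _; rewrite linearZ.
apply: (laurent_family_eq0 _ _ Pc) => {c Pc sc} [c Pc|c d cd Pc F Ftr]; last first.
  apply: subv1_reg; rewrite mulr0 mulr_sumr -[RHS](Pc F Ftr) big_seq [RHS]big_seq.
  by apply: eq_bigr => x xs; rewrite cd // mulrA.
have chi0 chi : has_trace chi -> \sum_(x <- s) eval1 (c x) * (chi x)%:R = 0.
  case=> F [Ftr FE]; have /(congr1 eval1) := Pc F Ftr.
  rewrite rmorph_sum rmorph0 /= => e; rewrite -[RHS]e; apply: eq_bigr => x _.
  by rewrite rmorphM /= FE.
(* A character positive at [x] kills the coefficient of [x] as soon as every other class on which it
   is positive already has coefficient 0 at v = 1. *)
have isolate chi x : has_trace chi -> x \in s -> (0 < chi x)%N ->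
    (forall y, y \in s -> y != x -> (0 < chi y)%N -> eval1 (c y) = 0) -> eval1 (c x) = 0.
  move=> /chi0 + xs chix chiy; rewrite (bigD1_seq x) //= big_seq_cond big1 ?addr0.
    move=> /eqP; rewrite mulf_eq0 => /orP[/eqP //|].
    by rewrite pnatr_eq0 => /eqP e; rewrite e in chix.
  move=> y /andP[ys yx]; have [->|chiy0] := posnP (chi y); first by rewrite mulr0.
  by rewrite chiy // mul0r.
have c1 x : x \in s -> linpart x = 1%g -> eval1 (c x) = 0.
  move=> xs x1.
  (* All coordinates of differences between a W-conjugate of a translation part and that of [x]: a
     modulus faithful on them turns congruence into conjugacy. *)
  pose ds := [seq (weyl_act w (transl y) - transl x).1 | y <- s, w <- enum 'S_3]
    ++ [seq (weyl_act w (transl y) - transl x).2 | y <- s, w <- enum 'S_3].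
  have [N NP] := Zp_intr_inj ds.
  apply: (isolate _ _ (transl_trace N (transl x)) xs).
    apply/card_gt0P; exists (0, 1%g); rewrite inE /transl_shift /transl_act /= x1 mulg1.
    by rewrite weyl_act1 add0r subrr.
  move=> y ys /eqP yx /card_gt0P[[p w]]; rewrite inE => /eqP[pE wE].
  have y1 : linpart y = 1%g by apply: (mulgI w); rewrite mulg1.
  case: yx; apply: s_conj => //; apply/conj_classP.
  exists (ExtW 0 w).
  have -> : y = t (transl y) by rewrite /t -y1; case: (y).
  have -> : x = t (transl x) by rewrite /t -x1; case: (x).
  rewrite extW_trans_mul; congr (t _ * _)%g.
  have pE' : modN N (weyl_act w (transl y)) = modN N (transl x).
    by apply: (addrI p); apply: (subIr (modN N (transl x))); rewrite pE addrK.
  apply/eqP; rewrite -subr_eq0; apply/eqP.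
  case: pE' => /eqP e1 /eqP e2; rewrite -subr_eq0 -mulrzBr in e1; rewrite -subr_eq0 -mulrzBr in e2.
  rewrite [LHS]surjective_pairing; congr pair; apply: NP; rewrite ?(eqP e1) ?(eqP e2) //.
  - by rewrite mem_cat; apply/orP; left; apply/allpairsP; exists (y, w); rewrite mem_enum.
  - by rewrite mem_cat; apply/orP; right; apply/allpairsP; exists (y, w); rewrite mem_enum.
have c2 x k : x \in s -> linpart x k = k -> eval1 (c x) = 0.
  move=> xs xk; have [/c1 ->//|x1] := eqVneq (linpart x) 1%g.
  have [N NP] := Zp_intr_inj [seq glide y j - glide x k | y <- s, j <- enum 'I_3].
  apply: (isolate _ _ (glide_trace N (glide x k)) xs).
    by apply/card_gt0P; exists (0, k); rewrite inE /glide_shift /glide_act /= xk add0r subrr.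
  move=> y ys /eqP yx /card_gt0P[[p j]]; rewrite inE => /eqP[pE jE].
  (* This character also sees translations, which are already dealt with; any other [y] that it sees
     has the same glide as [x] and is conjugate to it. *)
  have [/c1 ->//|y1] := eqVneq (linpart y) 1%g.
  case: yx; apply: s_conj => //.
  have pE' : (glide y j)%:~R = (glide x k)%:~R :> 'I_N.+2.
    by apply: (addrI p); apply: (subIr (glide x k)%:~R); rewrite pE addrK.
  have yxE : glide y j = glide x k.
    apply/eqP; rewrite -subr_eq0; apply/eqP/NP; last by rewrite mulrzBr pE' subrr.
    by apply/allpairsP; exists (y, j); rewrite mem_enum.
  have xG : glide_refl (glide x k) x by split=> //; exists k.
  have yG : glide_refl (glide x k) y by split=> //; exists j.
  move: xG yG; rewrite -conj_class_glide => xG yG; exact: conj_class_trans (conj_class_sym yG) xG.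
have c3 x : x \in s -> ~ rotation_type x -> eval1 (c x) = 0.
  by move=> xs /existsNP[k /negP/negPn/eqP xk]; apply: c2 xs xk.
move=> x xs; have [xr|/(c3 _ xs)//] := pselect (rotation_type x).
apply: (isolate _ _ (coset_trace (coset_rep x)) xs).
  by apply/card_gt0P; exists 0; rewrite inE add0r subrr.
move=> y ys /eqP yx /card_gt0P[a]; rewrite inE => /eqP aE.
have [yr|/(c3 _ ys)//] := pselect (rotation_type y).
case: yx; apply: s_conj => //; apply: conj_class_rotation => //.
by apply: (addrI a); apply: (subIr (coset_rep x)); rewrite aE addrK.
Qed.
End Independence.

(** * Reductions in the cocenter *)

Lemma len_extW p q :
  ((len (ExtW (p, q) 1%g) = (absz p + absz q + absz (p + q)%R)%N) *
   (len (ExtW (p, q) r1) = (absz (p - 1)%R + absz q + absz (p + q)%R)%N) *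
   (len (ExtW (p, q) r2) = (absz p + absz (q - 1)%R + absz (p + q)%R)%N) *
   (len (ExtW (p, q) (r1 * r2)%g)
      = (absz (p - 1)%R + absz q + absz (p + q - 1)%R)%N) *
   (len (ExtW (p, q) (r2 * r1)%g)
      = (absz p + absz (q - 1)%R + absz (p + q - 1)%R)%N) *
   (len (ExtW (p, q) (r1 * r2 * r1)%g)
      = (absz (p - 1)%R + absz (q - 1)%R + absz (p + q - 1)%R)%N))%type.
Proof.
do !split; rewrite len_dist /alcove_dist /rootv /window /= ?permE3 /lift3 /=; lia.
Qed.

Ltac extW_calc := apply: extW_ext; rewrite /= ?permE3 //;
  rewrite /weyl_act ?permE3 /lift3 /=; congr pair => /=; lia.

(** The coordinates are those of k alpha1 + n alpha2. Here n determines the class, as the glide is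
    3n, and k is the position relative to the axis. *)
Definition glide_elt (n k : int) : extW := ExtW (k + k - n, n + n - k) r1.
Definition transl_elt (n k : int) : extW := ExtW (k + k - n, n + n - k) 1%g.

Section Cocenter.
Variables (H : algType laurent) (T : extW -> H) (HT : is_hecke_algebra T).

Lemma commutator_span_lin a h k :
  @commutator_span H h -> commutator_span k -> commutator_span (a *: h + k).
Proof.
move=> [s [c ->]] [s' [c' ->]].
pose u := undup (s ++ s').
have uu : uniq u by apply: undup_uniq.
have su : {subset s <= u} by move=> x xs; rewrite mem_undup mem_cat xs.
have s'u : {subset s' <= u} by move=> x xs; rewrite mem_undup mem_cat xs orbT.
rewrite !(sum_count _ uu su) !(sum_count _ uu s'u) !scaler_sumr -!big_split /=.
exists u, (fun x => a * (c x *+ count_mem x s) + c' x *+ count_mem x s').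
by apply: eq_bigr => x _; rewrite scalerDl -scalerA !scalerMnl.
Qed.

Lemma commutator_span_comm a b : @commutator_span H (a * b - b * a).
Proof. by exists [:: (a, b)], (fun=> 1); rewrite big_seq1 scale1r. Qed.

Lemma commutator_span0 : @commutator_span H 0.
Proof. by exists [::], (fun=> 0); rewrite big_nil. Qed.

Definition cocenter_eq (h k : H) : Prop := commutator_span (h - k).

Lemma cocenter_eq_refl h : cocenter_eq h h.
Proof. by rewrite /cocenter_eq subrr; apply: commutator_span0. Qed.

Lemma cocenter_eq_lin a h k h' k' :
  cocenter_eq h k -> cocenter_eq h' k' -> cocenter_eq (a *: h + h') (a *: k + k').
Proof.
by move=> e e'; rewrite /cocenter_eq opprD addrACA -scalerBr; apply: commutator_span_lin.
Qed.

Lemma cocenter_eq_sym h k : cocenter_eq h k -> cocenter_eq k h.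
Proof.
move=> /(fun e => commutator_span_lin (-1) e commutator_span0).
by rewrite scaleN1r addr0 opprB.
Qed.

Lemma cocenter_eq_trans h k l : cocenter_eq h k -> cocenter_eq k l -> cocenter_eq h l.
Proof.
move=> e e'; have := commutator_span_lin 1 e e'.
by rewrite scale1r addrA subrK.
Qed.

Lemma cocenter_eqD h k h' k' :
  cocenter_eq h k -> cocenter_eq h' k' -> cocenter_eq (h + h') (k + k').
Proof. by move=> e e'; have := cocenter_eq_lin 1 e e'; rewrite !scale1r. Qed.

Lemma cocenter_eq_comm a b : cocenter_eq (a * b) (b * a).
Proof. exact: commutator_span_comm. Qed.

Lemma cocenter_shift i u x y : x = (u * aff_refl i)%g -> y = (aff_refl i * u)%g ->
  len x = (len u).+1 -> len y = (len u).+1 -> cocenter_eq (T x) (T y).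
Proof.
move=> -> -> lx ly; rewrite -!(hecke_mul HT) ?len_aff_refl ?addn1 ?add1n //.
exact: cocenter_eq_comm.
Qed.

(** Cyclicity turns T_s T_x T_s into T_x T_s^2, to which the quadratic relation applies. *)
Lemma cocenter_up i x y u : y = (aff_refl i * x * aff_refl i)%g ->
  u = (x * aff_refl i)%g -> len u = (len x).+1 -> len y = (len x).+2 ->
  cocenter_eq (T y) (T x + zz *: T u).
Proof.
move=> yE uE lu ly.
have Tu : T u = T x * T (aff_refl i) by rewrite (hecke_mul HT) -?uE // len_aff_refl addn1.
have -> : T y = T (aff_refl i) * T u.
  by rewrite (hecke_mul HT) uE mulgA -yE // -uE len_aff_refl lu ly.
apply: cocenter_eq_trans (cocenter_eq_comm _ _) _.
rewrite Tu -mulrA (hecke_sqr HT) mulrDr mulr1 -scalerAr; exact: cocenter_eq_refl.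
Qed.

Lemma len_tau_mul x : len (tau * x)%g = len x.
Proof.
have le y : (len (tau * y)%g <= len y)%N.
  have /len_leP[s [j [e le_s]]] := leqnn (len y).
  apply/len_leP; exists [seq (i + 1) | i <- s], j.+1; rewrite size_map; split=> //.
  by have := tau_word 1 s; rewrite expg1 => tw; rewrite {1}e mulgA tw -mulgA -expgS.
apply/eqP; rewrite eqn_leq le /=.
have E g : (g * (g * (g * x)) = g ^+ 3 * x)%g by rewrite !expgS expg0 mulg1 !mulgA.
have := E tau; rewrite tau3 mul1g => {1}<-.
by apply: leq_trans (le _) _; apply: leq_trans (le _) _.
Qed.

Lemma cocenter_tau x y : (tau * x = y * tau)%g -> cocenter_eq (T x) (T y).
Proof.
move=> e; have t3 : (tau * tau ^+ 2)%g = 1%g by rewrite -expgS tau3.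
have -> : y = (tau * x * tau ^+ 2)%g by rewrite e -mulgA t3 mulg1.
rewrite -(hecke_tau HT) -(hecke_mul HT) ?len_tau_mul ?(len_tauX 1) //.
rewrite -mulrA; apply/cocenter_eq_sym/(cocenter_eq_trans (cocenter_eq_comm _ _)).
rewrite -mulrA -(expg1 tau) (hecke_tau HT) -expgD tau3 (hecke_one HT) mulr1.
exact: cocenter_eq_refl.
Qed.

Lemma glide_elt_up n k : n < k + k ->
  cocenter_eq (T (glide_elt n (n - k))) (T (glide_elt n k) + zz *: T (transl_elt n k)).
Proof.
move=> nk; apply: (@cocenter_up 1); rewrite ?len_extW; try lia.
- by extW_calc.
- by extW_calc.
Qed.

(** This says that k lies between -n and 2n. There the length of [glide_elt n k] is |2k - n - 1| +
    3|n|, which is symmetric under k -> n - k + 1. *)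
Definition in_strip (n k : int) : bool :=
  (`|n + k| + `|n + n - k| == 3 * `|n|)%R.

Lemma glide_elt_flip n k : in_strip n k -> in_strip n (n - k + 1) ->
  cocenter_eq (T (glide_elt n k)) (T (glide_elt n (n - k + 1))).
Proof.
rewrite /in_strip => nk nk'.
pose y := ExtW (n + k, k - n - n) (r1 * r2 * r1)%g.
apply: (@cocenter_eq_trans _ (T y)); last first.
  by apply: cocenter_tau; extW_calc.
(* The sign of k + n tells on which side s_2 is a descent; both elements are then one longer than a
   common factor. *)
have [d|d] := ltP 0 (k + n).
  apply: (@cocenter_shift 2 (ExtW (k + k - n, n + n - k) (r1 * r2)%g));
    rewrite ?len_extW; try lia; by extW_calc.
apply/cocenter_eq_sym.
apply: (@cocenter_shift 2 (ExtW (n + k, k - n - n) (r2 * r1)%g));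
  rewrite ?len_extW; try lia; by extW_calc.
Qed.

Definition rot_elt (m : int) : extW := ExtW (- m, - m) (r2 * r1)%g.

Lemma cocenter_up_left i x y u : y = (aff_refl i * x * aff_refl i)%g ->
  u = (aff_refl i * x)%g -> len u = (len x).+1 -> len y = (len x).+2 ->
  cocenter_eq (T y) (T x + zz *: T u).
Proof.
move=> yE uE lu ly.
have Tu : T u = T (aff_refl i) * T x by rewrite (hecke_mul HT) -?uE // len_aff_refl add1n.
have -> : T y = T u * T (aff_refl i).
  by rewrite (hecke_mul HT) uE -yE // -uE len_aff_refl lu ly addn1.
rewrite Tu -mulrA; apply: cocenter_eq_trans (cocenter_eq_comm _ _) _.
rewrite -mulrA (hecke_sqr HT) mulrDr mulr1 -scalerAr.
apply: cocenter_eqD; first exact: cocenter_eq_refl.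
rewrite -[X in cocenter_eq X]addr0 -[X in cocenter_eq _ X]addr0.
by apply: cocenter_eq_lin; [apply: cocenter_eq_comm | apply: cocenter_eq_refl].
Qed.

Lemma refl_elt_step m : 0 <= m ->
  cocenter_eq (T (glide_elt 0 (m + 1))) (T (glide_elt 0 (- m)) + zz *: T (rot_elt m)).
Proof.
move=> m0; apply: (@cocenter_eq_trans _ (T (ExtW (- m, - m) (r1 * r2 * r1)%g))).
  by apply/cocenter_eq_sym/cocenter_tau; extW_calc.
by apply: (@cocenter_up_left 2); rewrite ?len_extW; try lia; extW_calc.
Qed.

(** Conjugating by s_1 and then by s_2 shortens by 2 each time and ends in a tau-conjugate of
    [rot_elt (m - 1)]; the two corrections are glide reflections of opposite glides. *)
Lemma rot_elt_step m : 0 < m ->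
  cocenter_eq (T (rot_elt m)) (T (rot_elt (m - 1))
    + (zz *: T (glide_elt m 0) + zz *: T (glide_elt (- m) 0))).
Proof.
move=> m0.
pose y := ExtW (m, - m - m) (r1 * r2)%g.
pose y' := ExtW (- m, m + m) (r2 * r1)%g.
pose g := ExtW (- m, - m) r2.
have e1 : cocenter_eq (T (rot_elt m)) (T y + zz *: T g).
  by apply: (@cocenter_up_left 1); rewrite ?len_extW; try lia; extW_calc.
have e2 : cocenter_eq (T y) (T y' + zz *: T (glide_elt (- m) 0)).
  by apply: (@cocenter_up_left 2); rewrite ?len_extW; try lia; extW_calc.
have e3 : cocenter_eq (T y') (T (rot_elt (m - 1))) by apply: cocenter_tau; extW_calc.
have e4 : cocenter_eq (T g) (T (glide_elt m 0)).
  by apply/cocenter_eq_sym/cocenter_tau; extW_calc.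
apply: cocenter_eq_trans e1 _.
rewrite [in X in cocenter_eq _ X]addrCA [X in cocenter_eq X]addrC.
apply: cocenter_eq_lin => //; apply: cocenter_eq_trans e2 _.
by apply: cocenter_eqD => //; apply: cocenter_eq_refl.
Qed.

(** Conjugating a translation by s_1 or s_2 preserves its length, and when the translation moves,
    both ends factor through a common element that is shorter by one. *)
Lemma transl_cocenter x w : cocenter_eq (T (t x)) (T (t (weyl_act w x))).
Proof.
have s1P y : cocenter_eq (T (t y)) (T (t (weyl_act r1 y))).
  case: y => p q; have -> : weyl_act r1 (p, q) = (- p, p + q).
    by rewrite /weyl_act ?permE3 /lift3 /=; congr pair => /=; lia.
  have [p0|p0|->] := ltgtP p 0; last by rewrite oppr0 add0r; apply: cocenter_eq_refl.
    apply/cocenter_eq_sym.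
    by apply: (@cocenter_shift 1 (ExtW (- p, p + q) r1)); rewrite ?len_extW; try lia; extW_calc.
  by apply: (@cocenter_shift 1 (ExtW (p, q) r1)); rewrite ?len_extW; try lia; extW_calc.
have s2P y : cocenter_eq (T (t y)) (T (t (weyl_act r2 y))).
  case: y => p q; have -> : weyl_act r2 (p, q) = (p + q, - q).
    by rewrite /weyl_act ?permE3 /lift3 /=; congr pair => /=; lia.
  have [q0|q0|->] := ltgtP q 0; last by rewrite oppr0 addr0; apply: cocenter_eq_refl.
    apply/cocenter_eq_sym.
    by apply: (@cocenter_shift 2 (ExtW (p + q, - q) r2));
      rewrite ?len_extW; try lia; extW_calc.
  by apply: (@cocenter_shift 2 (ExtW (p, q) r2)); rewrite ?len_extW; try lia; extW_calc.
move: w x; elim/S3P => x; rewrite ?weyl_actM.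
- by rewrite weyl_act1; apply: cocenter_eq_refl.
- exact: s1P.
- exact: s2P.
- exact: cocenter_eq_trans (s2P _) (s1P _).
- exact: cocenter_eq_trans (s1P _) (s2P _).
- exact: cocenter_eq_trans (cocenter_eq_trans (s1P _) (s2P _)) (s1P _).
Qed.
End Cocenter.

(** * Conjugacy classes *)

Lemma glide_reflP n x : glide_refl (3 * n) x <-> exists k,
  [\/ x = glide_elt n k, x = ExtW (- n - n - k, k + k + n) r2
    | x = ExtW (k + n, k - n - n) (r1 * r2 * r1)%g].
Proof.
split.
  case: x => [[a b] w] [/= w1 [k [wk]]]; rewrite /glide /lift3 /= => e.
  move: w k w1 wk e; elim/S3P; elim/I3P; rewrite ?permE3 // ?eqxx //= => _ _ e.
  - exists (n + n - b); apply: Or31; congr ExtW; congr pair; lia.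
  - exists (- n - n - a); apply: Or32; congr ExtW; congr pair; lia.
  - exists (a - n); apply: Or33; congr ExtW; congr pair; lia.
move=> [k [] ->]; split.
- by apply/eqP => /permP /(_ 0); rewrite /= ?permE3.
- by exists 2; rewrite /= ?permE3; split=> //; rewrite /glide /lift3 /=; lia.
- by apply/eqP => /permP /(_ 1); rewrite /= ?permE3.
- by exists 0; rewrite /= ?permE3; split=> //; rewrite /glide /lift3 /=; lia.
- by apply/eqP => /permP /(_ 0); rewrite /= ?permE3.
- by exists 1; rewrite /= ?permE3; split=> //; rewrite /glide /lift3 /=; lia.
Qed.

Lemma coweightMn (x : coweight) (n : nat) : x *+ n = (x.1 * n%:Z, x.2 * n%:Z).
Proof. by rewrite -coweightMz. Qed.

Lemma s121E : (s1 * s2 * s1)%g = ExtW 0 (r1 * r2 * r1)%g.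
Proof. by rewrite !extW_mulE /= !weyl_act0 !addr0. Qed.

Lemma t_mul x w : (t x * ExtW 0 w)%g = ExtW x w.
Proof. by rewrite extW_mulE /= weyl_act0 addr0 mul1g. Qed.

Ltac coweight_calc :=
  rewrite ?s121E ?t_mul; congr ExtW; rewrite ?coweightMz ?coweightMn; congr pair => /=; lia.

Lemma O1E : O1 = glide_refl 0.
Proof.
rewrite -[0]/(3 * 0 :> int); apply/seteqP; split=> x.
  move=> [k xk]; apply/glide_reflP; exists k.
  by case: xk => ->; [apply: Or31|apply: Or32|apply: Or33]; coweight_calc.
move=> /glide_reflP[k xk]; exists k.
by case: xk => ->; [apply: Or31|apply: Or32|apply: Or33]; coweight_calc.
Qed.

Lemma C_E (i : nat) : C_ i = glide_refl (3 * i%:Z).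
Proof.
apply/seteqP; split=> x.
  move=> [k xk]; apply/glide_reflP; exists k.
  by case: xk => ->; [apply: Or31|apply: Or32|apply: Or33]; coweight_calc.
move=> /glide_reflP[k xk]; exists k.
by case: xk => ->; [apply: Or31|apply: Or32|apply: Or33]; coweight_calc.
Qed.

Lemma C'_E (i : nat) : C'_ i = glide_refl (3 * - i%:Z).
Proof.
apply/seteqP; split=> x.
  move=> [k []] ->; apply/glide_reflP; [exists k; apply: Or31|exists k; apply: Or32|
    exists (k - i%:Z); apply: Or33]; coweight_calc.
(* [C'_] and [glide_reflP] parametrise the third family with an offset i, hence k - i above and k +
   i here. *)
move=> /glide_reflP[k []] ->; [exists k; apply: Or31|exists k; apply: Or32|
    exists (k + i%:Z); apply: Or33]; coweight_calc.
Qed.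

Lemma root_latticeE y : root_lattice y <-> ((y.1 + 2 * y.2) %% 3 = 0)%Z.
Proof.
case: y => p q; split=> [[a [b]]|/= e].
  by rewrite !coweightMz => -[-> ->] /=; lia.
exists ((p + p + q) %/ 3)%Z, ((p + q + q) %/ 3)%Z.
by rewrite !coweightMz; congr pair => /=; lia.
Qed.

Lemma coset_rep0 x : coset_rep x = 0 <-> root_lattice (transl x).
Proof.
rewrite root_latticeE; split=> [/eqP|e]; last apply/eqP; rewrite /coset_rep Zp_intr_eq0.
  by move/dvdz_mod0P.
by apply/dvdz_mod0P.
Qed.

Lemma s12E : (s1 * s2)%g = ExtW 0 (r1 * r2)%g.
Proof. by rewrite !extW_mulE /= !weyl_act0 !addr0. Qed.

Lemma s21E : (s2 * s1)%g = ExtW 0 (r2 * r1)%g.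
Proof. by rewrite !extW_mulE /= !weyl_act0 !addr0. Qed.

Lemma O2E x : O2 x <-> rotation_type x /\ coset_rep x = 0.
Proof.
rewrite coset_rep0; split.
  by move=> [y yQ [] ->]; rewrite ?s12E ?s21E t_mul; split=> // k; elim/I3P: k; rewrite /= !permE3.
case: x => y w [xr /= yQ]; exists y; rewrite ?s12E ?s21E ?t_mul //.
have := (xr 0, xr 1, xr 2); rewrite /=.
by elim/S3P: w {xr}; rewrite !permE3 ?eqxx => -[[z0 z1] z2] //; [left|right].
Qed.

Lemma conj_class_O2 : conj_class (s2 * s1)%g = O2.
Proof.
have x0 : O2 (s2 * s1)%g.
  exists 0; last by right; rewrite s21E t_mul.
  by exists 0, 0; rewrite !mulr0z addr0.
apply/seteqP; split=> x; last first.
  by move: x0 => /O2E[r0 c0] /O2E[r1 c1]; apply: conj_class_rotation; rewrite ?c0.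
move=> /conj_classP[g e]; move/O2E: x0 => [x0 c0]; apply/O2E; split.
  have xE : (s2 * s1 = g^-1 * x * g)%g by rewrite -mulgA -e mulKg.
  move=> k; apply/eqP => xk; have := x0 (linpart g k); rewrite xE !linpartM.
  have -> : linpart g^-1%g (linpart g k) = k by rewrite -linpartM mulgV /= perm1.
  by rewrite xk eqxx.
by have := congr1 coset_rep e; rewrite coset_repM c0 addr0 coset_repM -[LHS]add0r => /addIr.
Qed.

Lemma conj_class_transl x y : O_ x y <-> exists w, y = t (weyl_act w x).
Proof.
split=> [/conj_classP[g e]|[w ->]]; last first.
  by apply/conj_classP; exists (ExtW 0 w); rewrite extW_trans_mul.
have u1 : linpart y = 1%g.
  by apply: (mulIg (linpart g)); have := congr1 linpart e; rewrite !extW_mulE /= mulg1 mul1g.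
exists (linpart g); have := congr1 transl e; rewrite !extW_mulE /= u1 weyl_act1 addrC.
by move/addIr => ->; rewrite /t -u1; case: (y).
Qed.

Lemma dominant_inj x y : dominant x -> dominant y -> O_ x = O_ y -> x = y.
Proof.
move=> xD yD xy; have : O_ x (t y) by rewrite xy; apply: conj_class_refl.
move=> /conj_class_transl[w [yE]]; move: xD yD; rewrite yE.
case: x {xy yE} => p q; elim/S3P: w; rewrite /dominant /weyl_act /= ?permE3 /lift3 /=;
  move=> [xp xq] [yp yq]; congr pair => /=; lia.
Qed.

Lemma glide_refl_inj m m' : glide_refl m = glide_refl m' -> m = m'.
Proof.
move=> e; have : glide_refl m (ExtW (m, 0) r1) by rewrite -conj_class_glide; apply: conj_class_refl.
rewrite e => -[_ [k []]] /=; elim/I3P: k; rewrite !permE3 // => _.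
by rewrite /glide /lift3 /= mulr0 addr0 subr0.
Qed.

Lemma glide_refl_transl m x : glide_refl m <> O_ x.
Proof.
by move=> e; have : glide_refl m (t x) by [rewrite e; apply: conj_class_refl]; case=> /=; rewrite eqxx.
Qed.

Lemma glide_refl_O2 m : glide_refl m <> O2.
Proof.
move=> e; have : O2 (s2 * s1)%g by rewrite -conj_class_O2; apply: conj_class_refl.
by rewrite -e => -[_ [k []]]; elim/I3P: k; rewrite s21E /= !permE3.
Qed.

Lemma O2_transl x : O2 <> O_ x.
Proof.
move=> e; have : O2 (t x) by rewrite e; apply: conj_class_refl.
by move=> /O2E[/(_ 0)]; rewrite /= perm1 eqxx.
Qed.

(** * Expansions of arbitrary elements in the classes of the cocenter *)

Section Expansion.
Variables (H : algType laurent) (T : extW -> H) (HT : is_hecke_algebra T).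

(** The clauses of [is_class_poly] for any [h] in place of [T w], so that expansions can be combined
    linearly. *)
Definition expands (h : H) (f : set extW -> laurent) : Prop :=
  [/\ finite_set [set O | f O != 0],
      [set O | f O != 0] `<=` conj_classes
    & forall m : set extW -> extW,
        (forall O, conj_classes O -> min_length_in O (m O)) ->
        commutator_span (h - \sum_(O \in conj_classes) f O *: T (m O))].

Lemma fsum_classes (f : set extW -> laurent) (g : set extW -> H) (r : seq (set extW)) :
  uniq r -> [set` r] `<=` conj_classes -> [set O | f O != 0] `<=` [set` r] ->
  \sum_(O \in conj_classes) f O *: g O = \sum_(O <- r) f O *: g O.
Proof.
move=> ur rC fr; rewrite (@fsbigE _ _ _ _ _ r) //; last first.
  move=> O _ Or; have [->|fO] := eqVneq (f O) 0; first by rewrite scale0r.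
  by case/negP: Or; apply: (fr O fO).
rewrite big_seq_cond [RHS]big_seq; apply: eq_bigl => O.
by case Or: (O \in r) => //=; apply/mem_set/rC.
Qed.

Lemma expands_lin a h k f g : expands h f -> expands k g ->
  expands (a *: h + k) (fun O => a * f O + g O).
Proof.
move=> [ffin fC fE] [gfin gC gE].
have sub : [set O | a * f O + g O != 0] `<=` [set O | f O != 0] `|` [set O | g O != 0].
  move=> O /=; have [->|] := eqVneq (f O) 0; last by left.
  by rewrite mulr0 add0r; right.
have fgfin : finite_set ([set O | f O != 0] `|` [set O | g O != 0]) by rewrite finite_setU.
split=> [||m mP].
- exact: sub_finite_set fgfin.
- by move=> O /sub[/fC|/gC].
have /finite_seqP[r0 r0E] := fgfin.
have rE : [set` undup r0] = [set O | f O != 0] `|` [set O | g O != 0].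
  by rewrite r0E; apply/seteqP; split=> O /=; rewrite mem_undup.
have rC : [set` undup r0] `<=` conj_classes by rewrite rE => O [/fC|/gC].
have sf : [set O | f O != 0] `<=` [set` undup r0] by rewrite rE; left.
have sg : [set O | g O != 0] `<=` [set` undup r0] by rewrite rE; right.
have sfg : [set O | a * f O + g O != 0] `<=` [set` undup r0] by rewrite rE.
rewrite (fsum_classes _ (undup_uniq _) rC sfg).
have := commutator_span_lin a (fE m mP) (gE m mP).
rewrite (fsum_classes _ (undup_uniq _) rC sf) (fsum_classes _ (undup_uniq _) rC sg).
rewrite scalerBr addrACA -opprD scaler_sumr -big_split /=.
by under eq_bigr do rewrite scalerA -scalerDl.
Qed.

Lemma expands_eq h k f : cocenter_eq h k -> expands k f -> expands h f.
Proof.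
move=> hk [ffin fC fE]; split=> // m mP.
exact: cocenter_eq_trans hk (fE m mP).
Qed.

Definition class_delta (O O' : set extW) : laurent := (O' == O)%:R.

(** The hypothesis covers every minimal length [y] because an expansion is tested against all
    choices of representatives. *)
Lemma expands_class x O : conj_classes O ->
  (forall y, min_length_in O y -> cocenter_eq (T x) (T y)) -> expands (T x) (class_delta O).
Proof.
move=> OC xE; have supp : [set O' | class_delta O O' != 0] `<=` [set` [:: O]].
  by move=> O' /=; rewrite /class_delta inE; case: (O' == O); rewrite ?eqxx.
have sC : [set` [:: O]] `<=` conj_classes by move=> O' /=; rewrite inE => /eqP ->.
split=> [||m mP].
- exact: sub_finite_set supp (finite_seq _).
- exact: subset_trans supp sC.
by rewrite (fsum_classes _ _ sC supp) // big_seq1 /class_delta eqxx scale1r; apply/xE/mP.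
Qed.

End Expansion.

Section Reduction.
Variables (H : algType laurent) (T : extW -> H) (HT : is_hecke_algebra T).

Lemma expands_transl x : expands T (T (t x)) (class_delta (O_ x)).
Proof.
apply: expands_class => [|y [/conj_class_transl[w ->] _]]; first by exists (t x).
exact: (transl_cocenter HT).
Qed.

Lemma len_tau_conj x y : (tau * x = y * tau)%g -> len x = len y.
Proof. by move=> e; rewrite -len_tau_mul e len_tau. Qed.

Lemma expands_O2 : expands T (T (rot_elt 0)) (class_delta O2).
Proof.
apply: expands_class => [|y [yO2 ymin]].
  by exists (s2 * s1)%g => //; apply: conj_class_O2.
have {ymin} ymin : (len y <= 2)%N.
  apply: leq_trans (ymin (rot_elt 0) _) _; last by rewrite len_extW.
  by apply/O2E; split=> [k|]; [elim/I3P: k; rewrite /= !permE3|apply: val_inj].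
pose A a b := ExtW (a, b) (r1 * r2)%g; pose B a b := ExtW (a, b) (r2 * r1)%g.
have B01 : cocenter_eq (T (rot_elt 0)) (T (B 1 1)) by apply: (cocenter_tau HT); extW_calc.
have B12 : cocenter_eq (T (B 1 1)) (T (B (- 1) 2)) by apply: (cocenter_tau HT); extW_calc.
have BA : cocenter_eq (T (rot_elt 0)) (T (A 0 0)).
  by apply: (@cocenter_shift _ _ HT 1 s2); rewrite ?len_extW; try extW_calc.
have A02 : cocenter_eq (T (A 0 0)) (T (A 2 (- 1))) by apply: (cocenter_tau HT); extW_calc.
have A21 : cocenter_eq (T (A 2 (- 1))) (T (A 1 1)) by apply: (cocenter_tau HT); extW_calc.
have BA2 := cocenter_eq_trans BA A02; have BA1 := cocenter_eq_trans BA2 A21.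
have B02 := cocenter_eq_trans B01 B12.
move/O2E: yO2 => [yr /coset_rep0/root_latticeE].
case: y yr ymin => [[a b] w] yr /= ymin yQ.
have := (yr 0, yr 1, yr 2); rewrite /=.
elim/S3P: w {yr} ymin; rewrite !permE3 ?eqxx => ymin -[[z0 z1] z2] //.
  (* Length at most 2 leaves three elements for each of the two rotations; tau permutes each triple,
     and conjugation by s_1 links the triples. *)
  have : [\/ (a, b) = (0, 0), (a, b) = (2, - 1) | (a, b) = (1, 1)].
    have : a = 0 /\ b = 0 \/ a = 2 /\ b = - 1 \/ a = 1 /\ b = 1.
      by move: ymin; rewrite len_extW => ymin; lia.
    by case=> [|[]] [-> ->]; [apply: Or31|apply: Or32|apply: Or33].
  by case=> ->.
have : [\/ (a, b) = (0, 0), (a, b) = (1, 1) | (a, b) = (- 1, 2)].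
  have : a = 0 /\ b = 0 \/ a = 1 /\ b = 1 \/ a = - 1 /\ b = 2.
    by move: ymin; rewrite len_extW => ymin; lia.
  by case=> [|[]] [-> ->]; [apply: Or31|apply: Or32|apply: Or33].
by case=> -> //; apply: cocenter_eq_refl.
Qed.

Lemma glide_refl_normal n y : glide_refl (3 * n) y ->
  exists k, cocenter_eq (T (glide_elt n k)) (T y) /\ len y = len (glide_elt n k).
Proof.
move=> /glide_reflP[k [] ->].
- by exists k; split=> //; apply: cocenter_eq_refl.
- have e : (tau * glide_elt n (n + k) = ExtW (- n - n - k, k + k + n) r2 * tau)%g.
    by extW_calc.
  by exists (n + k); split; [apply: (cocenter_tau HT) | rewrite (len_tau_conj e)].
- have e : (tau * ExtW (k + n, k - n - n) (r1 * r2 * r1) = glide_elt n (n - k + 1) * tau)%g.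
    by extW_calc.
  by exists (n - k + 1); split; [apply/cocenter_eq_sym/(cocenter_tau HT) | rewrite (len_tau_conj e)].
Qed.

(** A minimum of |2k - n - 1|. For even n there is one other minimum, n - k + 1, which the flip
    exchanges with it. *)
Definition axis_pos (n : int) : int := ((n + 1) %/ 2)%Z.

Lemma glide_elt_class n k : glide_refl (3 * n) (glide_elt n k).
Proof. by apply/glide_reflP; exists k; apply: Or31. Qed.

Lemma glide_elt_min n k : (len (glide_elt n k) <= len (glide_elt n (axis_pos n)))%N ->
  cocenter_eq (T (glide_elt n k)) (T (glide_elt n (axis_pos n))).
Proof.
rewrite !len_extW /axis_pos => le_k.
have [->|kn] := eqVneq k ((n + 1) %/ 2)%Z; first exact: cocenter_eq_refl.
have -> : ((n + 1) %/ 2)%Z = n - k + 1 by lia.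
by apply: (glide_elt_flip HT) => //; rewrite /in_strip; lia.
Qed.

Lemma expands_glide n k : (len (glide_elt n k) <= len (glide_elt n (axis_pos n)))%N ->
  expands T (T (glide_elt n k)) (class_delta (glide_refl (3 * n))).
Proof.
move=> le_k; apply: expands_class => [|y [yC ymin]].
  by exists (ExtW (3 * n, 0) r1) => //; apply: conj_class_glide.
have [j [yE lyE]] := glide_refl_normal yC.
apply: cocenter_eq_trans yE; apply: cocenter_eq_trans (glide_elt_min le_k) _.
apply/cocenter_eq_sym/glide_elt_min; rewrite -lyE.
exact/ymin/glide_elt_class.
Qed.

(** One move from k to k - 1 flips k to n - (k - 1) at constant length and then shortens by s_1. The
    bound 2J < m keeps the moves on one side of the axis. *)
Lemma glide_chain n K (m J : nat) : K + K - n = m%:Z -> (2 * J < m)%N ->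
    (n = m%:Z \/ n = - m%:Z) ->
  cocenter_eq (T (glide_elt n K))
    (T (glide_elt n (K - J%:Z)) + zz *: \sum_(0 <= j < J) T (transl_elt n (K - j.+1%:Z))).
Proof.
move=> nK + nm; elim: J => [|J IHJ] Jm.
  by rewrite subr0 big_geq // scaler0 addr0; apply: cocenter_eq_refl.
apply: cocenter_eq_trans (IHJ _) _; first by lia.
rewrite big_nat_recr //= scalerDr addrA addrAC.
apply: cocenter_eqD; last exact: cocenter_eq_refl.
apply: (@cocenter_eq_trans _ _ (T (glide_elt n (n - (K - J%:Z) + 1)))).
  by apply: (glide_elt_flip HT) => //; rewrite /in_strip; lia.
have -> : n - (K - J%:Z) + 1 = n - (K - J.+1%:Z) by lia.
by apply: (glide_elt_up HT); lia.
Qed.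
End Reduction.

(** * Expansions in terms of minimal length elements *)

(** Coordinates of m theta - j alpha1; [dom_pt'] is the same with alpha2. *)
Definition dom_pt (m j : nat) : coweight := (m%:Z - (j + j)%:Z, m%:Z + j%:Z).
Definition dom_pt' (m j : nat) : coweight := (m%:Z + j%:Z, m%:Z - (j + j)%:Z).

Lemma O_weyl w x y : y = weyl_act w x -> O_ x = O_ y.
Proof. by move=> ->; apply: conj_class_eq; apply/conj_class_transl; exists w. Qed.

Ltac weyl_calc := rewrite /weyl_act /= ?permE3 /lift3 /=; congr pair => /=; lia.

(** The increment from R_(i-1) to R_i, divided by [zz]. The bound [i.-1./2] counts the j >= 1 with
    2j < i. *)
Definition step_poly (i : nat) (O : set extW) : laurent :=
  class_delta (C_ i) O + class_delta (C'_ i) O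
  + zz * (class_delta (O_ (dom_pt i 0)) O
  + \sum_(0 <= j < i.-1./2) class_delta (O_ (dom_pt i j.+1)) O
  + \sum_(0 <= j < i.-1./2) class_delta (O_ (dom_pt' i j.+1)) O).

Definition rot_poly (m : nat) (O : set extW) : laurent :=
  class_delta O2 O + zz * \sum_(1 <= i < m.+1) step_poly i O.

(** Two bounds are needed because rotation and translation terms are added alternately: a_m has
    bounds (m, m) and a_(-m) has (m, m+1). *)
Definition refl_poly (a b : nat) (O : set extW) : laurent :=
  class_delta O1 O + zz * \sum_(0 <= i < a) rot_poly i O
  + zz * \sum_(1 <= i < b) class_delta (O_ (dom_pt i 0)) O.

Section Reduction.
Variables (H : algType laurent) (T : extW -> H) (HT : is_hecke_algebra T).

Lemma expands_ext h f g : f =1 g -> expands T h f -> expands T h g.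
Proof. by move=> /funext ->. Qed.

Lemma expands0 : expands T 0 (fun=> 0).
Proof.
split=> [||m mP].
- by rewrite (_ : [set _ | _] = set0) //; apply/seteqP; split=> O //=; rewrite eqxx.
- by move=> O /=; rewrite eqxx.
- by rewrite fsbig1 ?subr0; [apply: commutator_span0|move=> O _; rewrite scale0r].
Qed.

Lemma expandsD h k f g : expands T h f -> expands T k g ->
  expands T (h + k) (fun O => f O + g O).
Proof.
move=> hf kg; have := expands_lin 1 hf kg; rewrite scale1r.
by apply: expands_ext => O; rewrite mul1r.
Qed.

Lemma expandsZ a h f : expands T h f -> expands T (a *: h) (fun O => a * f O).
Proof.
move=> hf; have := expands_lin a hf expands0; rewrite addr0.
by apply: expands_ext => O; rewrite addr0.
Qed.

Lemma expands_sum (r : seq nat) (h : nat -> H) f : (forall j, expands T (h j) (f j)) ->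
  expands T (\sum_(j <- r) h j) (fun O => \sum_(j <- r) f j O).
Proof.
move=> hf; elim: r => [|j r IHr].
  by rewrite big_nil; apply: expands_ext expands0 => O; rewrite big_nil.
by rewrite big_cons; apply: expands_ext (expandsD (hf j) IHr) => O; rewrite big_cons.
Qed.

Lemma expands_chain n K (m : nat) : (0 < m)%N -> K + K - n = m%:Z ->
    (n = m%:Z \/ n = - m%:Z) ->
  expands T (T (glide_elt n K)) (fun O => class_delta (glide_refl (3 * n)) O
    + zz * \sum_(0 <= j < m.-1./2)
        class_delta (O_ (transl (transl_elt n (K - j.+1%:Z)))) O).
Proof.
move=> m0 nK nm.
have [J2 J2'] : (2 * m.-1./2 < m)%N /\ (m <= 2 * m.-1./2 + 2)%N.
  have := odd_double_half m.-1; rewrite -mul2n; case: (odd _) => /=; lia.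
apply: expands_eq (glide_chain HT nK J2 nm) _; apply: expandsD.
  apply: (expands_glide HT); rewrite !len_extW /axis_pos; lia.
by apply/expandsZ/expands_sum => j; apply: (expands_transl HT).
Qed.

Lemma expands_rot (m : nat) : expands T (T (rot_elt m)) (rot_poly m).
Proof.
elim: m => [|m IHm].
  apply: expands_ext (expands_O2 HT) => O.
  by rewrite /rot_poly big_geq // mulr0 addr0.
have m0 : (0 : int) < m.+1%:Z by [].
apply: expands_eq (rot_elt_step HT m0) _.
have -> : m.+1%:Z - 1 = m%:Z by lia.
have e1 := @expands_chain m.+1%:Z m.+1%:Z m.+1 isT ltac:(lia) ltac:(lia).
have e2 := @expands_chain (- m.+1%:Z) 0 m.+1 isT ltac:(lia) ltac:(lia).
(* For positive n the position k = 0 is across the axis from the start k = n of the chain; the extra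
   conjugation produces the class of n theta, which has no counterpart for -n. *)
have up : cocenter_eq (T (glide_elt m.+1%:Z 0))
    (T (glide_elt m.+1%:Z m.+1%:Z) + zz *: T (t (dom_pt m.+1 0))).
  have := @glide_elt_up _ _ HT m.+1%:Z m.+1%:Z ltac:(lia); rewrite subrr.
  by rewrite (_ : transl_elt _ _ = t (dom_pt m.+1 0)) //; congr ExtW; congr pair; lia.
have e3 := expands_eq up (expandsD e1 (expandsZ zz (expands_transl HT (dom_pt m.+1 0)))).
apply: expands_ext (expandsD IHm (expandsD (expandsZ zz e3) (expandsZ zz e2))) => O.
have stepE : step_poly m.+1 O = _ := erefl; rewrite [in RHS]/step_poly C_E C'_E in stepE.
rewrite /rot_poly [in RHS]big_nat_recr //= stepE.
have -> : \sum_(0 <= j < m./2) class_delta (O_ (dom_pt m.+1 j.+1)) O =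
    \sum_(0 <= j < m./2) class_delta (O_ (transl (transl_elt m.+1 (m.+1%:Z - j.+1%:Z)))) O.
  by apply: eq_bigr => j _; congr (class_delta (O_ _) _); congr pair => /=; lia.
have -> : \sum_(0 <= j < m./2) class_delta (O_ (dom_pt' m.+1 j.+1)) O =
    \sum_(0 <= j < m./2) class_delta (O_ (transl (transl_elt (- m.+1%:Z) (0 - j.+1%:Z)))) O.
  apply: eq_bigr => j _; congr (class_delta _ _).
  by apply: (@O_weyl (r2 * r1)%g); weyl_calc.
ring.
Qed.

Lemma expands_refl (m : nat) :
  expands T (T (glide_elt 0 m%:Z)) (refl_poly m m) /\
  expands T (T (glide_elt 0 (- m%:Z))) (refl_poly m m.+1).
Proof.
have up k : expands T (T (glide_elt 0 k%:Z)) (refl_poly k k) ->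
    expands T (T (glide_elt 0 (- k%:Z))) (refl_poly k k.+1).
  (* At k = 0 the two elements coincide and no translation term appears. *)
  case: k => [|k]; first by apply: expands_ext => O; rewrite /refl_poly !big_geq.
  move=> ek; have := @glide_elt_up _ _ HT 0 k.+1%:Z ltac:(lia); rewrite sub0r => /expands_eq; apply.
  apply: expands_ext (expandsD ek (expandsZ zz (expands_transl HT _))) => O.
  rewrite /refl_poly [\sum_(1 <= i < k.+2) _]big_nat_recr //= mulrDr addrA.
  congr (_ + _ * class_delta _ _).
  by apply: (@O_weyl r2); weyl_calc.
elim: m => [|m [_ IHm]].
  have e0 : expands T (T (glide_elt 0 0)) (refl_poly 0 0).
    have := @expands_glide _ _ HT 0 0; rewrite !len_extW => /(_ isT).
    by apply: expands_ext => O; rewrite /refl_poly !big_geq // !mulr0 !addr0 O1E.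
  by split=> //; apply: (up 0%N).
suff e : expands T (T (glide_elt 0 m.+1%:Z)) (refl_poly m.+1 m.+1) by split=> //; apply: up.
have := @refl_elt_step _ _ HT m%:Z isT; rewrite (_ : m%:Z + 1 = m.+1%:Z); last by lia.
move=> /expands_eq; apply.
apply: expands_ext (expandsD IHm (expandsZ zz (expands_rot m))) => O.
by rewrite /refl_poly [\sum_(0 <= i < m.+1) _]big_nat_recr //=; ring.
Qed.
End Reduction.

(** * Uniqueness of expansions and the class polynomials of the reflections *)

Lemma min_length_ex O : conj_classes O -> exists x, min_length_in O x.
Proof.
move=> [x0 _ <-]; have ex : exists n, `[< exists2 x, conj_class x0 x & len x = n >].
  by exists (len x0); apply/asboolP; exists x0 => //; apply: conj_class_refl.
case: (ex_minnP ex) => n /asboolP[x xO xn] nmin; exists x; split=> // y yO.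
by rewrite xn; apply: nmin; apply/asboolP; exists y.
Qed.

Lemma conj_classes_eq O x : conj_classes O -> O x -> O = conj_class x.
Proof. by move=> [y _ <-] /conj_class_eq. Qed.

Section Uniqueness.
Variables (H : algType laurent) (T : extW -> H) (HT : is_hecke_algebra T).

Lemma expands_inj h f g : expands T h f -> expands T h g -> f = g.
Proof.
move=> hf hg; pose d O := -1 * f O + g O.
have [dfin dC dE] : expands T (-1 *: h + h) d := expands_lin (-1) hf hg.
have /choice[m mP] O : exists x, conj_classes O -> min_length_in O x.
  have [/min_length_ex[x]|] := pselect (conj_classes O); first by exists x.
  (* Sets that are not conjugacy classes get a dummy representative. *)
  by exists 1%g.
have := dE m (fun O => mP O); rewrite scaleN1r addNr sub0r => dm.
have mK O : conj_classes O -> conj_class (m O) = O.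
  by move=> OC; rewrite -(conj_classes_eq OC (mP O OC).1).
have /finite_seqP[r0 r0E] := dfin; pose r := undup r0.
have rE : [set` r] = [set O | d O != 0].
  by rewrite r0E; apply/seteqP; split=> O /=; rewrite mem_undup.
have rC O : O \in r -> conj_classes O by move=> Or; apply: dC; rewrite -rE.
have minj : {in r &, injective m}.
  by move=> O O' /rC OC /rC OC' e; rewrite -(mK O OC) e mK.
have um : uniq (map m r) by rewrite map_inj_in_uniq // undup_uniq.
have d0 : forall x, x \in map m r -> d (conj_class x) = 0.
  apply: (class_independence HT um) => [x y /mapP[O Or ->] /mapP[O' Or' ->] /conj_class_eq|].
    by rewrite (mK _ (rC _ Or)) (mK _ (rC _ Or')) => ->.
  have := commutator_span_lin (-1) dm (@commutator_span0 H); rewrite addr0 scaleN1r opprK.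
  rewrite (@fsum_classes _ d (fun O => T (m O)) r) ?undup_uniq // ?rE //.
  rewrite big_map; congr commutator_span; apply: eq_big_seq => O Or.
  by rewrite (mK _ (rC _ Or)).
apply/funext => O; have [dO|dO] := eqVneq (d O) 0.
  by apply/eqP; rewrite eq_sym -subr_eq0 addrC -mulN1r; apply/eqP.
have Or : O \in r by have : [set O | d O != 0] O by []; rewrite -rE.
by case/eqP: dO; rewrite -(mK O (rC O Or)); apply: d0; apply: map_f.
Qed.

Lemma class_polyE w f : expands T (T w) f -> class_poly T w = f.
Proof.
move=> wf; have fu : unique (is_class_poly T w) f by split=> // g; apply: expands_inj.
have /= [pE pu] := @xgetPex _ (fun=> 0) [set f | unique (is_class_poly T w) f] (ex_intro _ f fu).
exact: pu.
Qed.

(** Up to tau, [w] is [glide_elt 0 j], of length |2j - 1| + 2|j|. This is 4j - 1 for j > 0 and 1 -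
    4j for j <= 0, so the two cases are j = k and j = -(k - 1). *)
Lemma reflection_class_poly w (k : nat) : (0 < k)%N -> O1 w ->
  (len w = (4 * k - 1)%N -> class_poly T w = refl_poly k k) /\
  (len w = (4 * k - 3)%N -> class_poly T w = refl_poly k.-1 k).
Proof.
move=> k0; rewrite O1E -[0]/(3 * 0 :> int) => /(glide_refl_normal HT)[j [wj ->]].
rewrite len_extW; split=> e; apply: class_polyE; apply: expands_eq (cocenter_eq_sym wj) _.
  have -> : j = k%:Z by lia.
  exact: (expands_refl HT k).1.
have -> : j = - k.-1%:Z by lia.
by have := (expands_refl HT k.-1).2; rewrite prednK.
Qed.
End Uniqueness.

(** * Reading off the coefficient of each class *)

Lemma class_delta_neq K O : O <> K -> class_delta K O = 0.
Proof. by rewrite /class_delta; case: eqP. Qed.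

Lemma class_delta_id K : class_delta K K = 1.
Proof. by rewrite /class_delta eqxx. Qed.

Lemma sum_delta (F : nat -> laurent) (m k n : nat) :
  \sum_(m <= i < k) F i * (i == n)%:R = if (m <= n < k)%N then F n else 0.
Proof.
elim: k => [|k IHk]; first by rewrite big_geq // ltn0 andbF.
have [mk|km] := leqP m k; last first.
  by rewrite big_geq // (_ : (_ <= _ < _)%N = false) //; lia.
rewrite big_nat_recr //= IHk; have [<-|kn] := eqVneq k n.
  by rewrite ltnn andbF add0r mulr1 mk ltnSn.
by rewrite mulr0 addr0 [(n < k.+1)%N]ltnS [(n <= k)%N]leq_eqVlt [n == k]eq_sym (negPf kn).
Qed.

Lemma sum_weightS (s : nat -> laurent) a :
  \sum_(1 <= i < a.+1) (a.+1 - i)%:R * s i =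
  \sum_(1 <= i < a) (a - i)%:R * s i + \sum_(1 <= i < a.+1) s i.
Proof.
case: a => [|a]; first by rewrite !big_geq // addr0.
rewrite ![\sum_(1 <= i < a.+2) _]big_nat_recr //= subSnn mul1r addrA -big_split /=.
congr (_ + _); apply: eq_big_nat => i /andP[_ ia].
by rewrite (subSn (ltnW ia)) -natr1 mulrDl mul1r.
Qed.

(** [step_poly i] is part of [rot_poly m] for every m with i <= m < a, which is the origin of the
    factor a - i. *)
Lemma sum_rot_poly a O : \sum_(0 <= i < a) rot_poly i O =
  a%:R * class_delta O2 O + zz * \sum_(1 <= i < a) (a - i)%:R * step_poly i O.
Proof.
elim: a => [|a IHa]; first by rewrite !big_geq // mul0r mulr0 addr0.
rewrite big_nat_recr //= IHa /rot_poly (sum_weightS (step_poly^~ O)).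
by rewrite -natr1; ring.
Qed.

Lemma step_poly_sum a n c O : (0 < n)%N ->
  (forall i, (0 < i)%N -> step_poly i O = c * (i == n)%:R) ->
  \sum_(1 <= i < a) (a - i)%:R * step_poly i O = (a - n)%:R * c.
Proof.
move=> n0 stepE.
rewrite (eq_big_nat _ _ (F2 := fun i => (a - i)%:R * c * (i == n)%:R)); last first.
  by move=> i /andP[i0 _]; rewrite stepE // mulrA.
rewrite sum_delta n0 /=; case: ltnP => // an.
(* Truncated subtraction gives 0 beyond the range, so the formula needs no bound on n. *)
by move: an; rewrite -subn_eq0 => /eqP ->; rewrite mul0r.
Qed.

Lemma refl_polyE a b O : refl_poly a b O = class_delta O1 O
  + zz * (a%:R * class_delta O2 O + zz * \sum_(1 <= i < a) (a - i)%:R * step_poly i O)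
  + zz * \sum_(1 <= i < b) class_delta (O_ (dom_pt i 0)) O.
Proof. by rewrite /refl_poly sum_rot_poly. Qed.

Lemma half_lt (i j : nat) : (j < i.-1./2)%N = (2 * j.+1 < i)%N.
Proof. have := odd_double_half i.-1; rewrite -mul2n; case: (odd _) => /=; lia. Qed.

Lemma dom_pt_dominant i j : (2 * j <= i)%N -> dominant (dom_pt i j) /\ dominant (dom_pt' i j).
Proof. by move=> ji; split; split=> /=; lia. Qed.

Lemma delta_transl x y : dominant x -> dominant y -> class_delta (O_ x) (O_ y) = (y == x)%:R.
Proof.
move=> xD yD; have [->|yx] := eqVneq y x; first by rewrite class_delta_id.
by rewrite class_delta_neq // => e; case/eqP: yx; apply: dominant_inj.
Qed.

Lemma step_poly_transl i y : dominant y -> step_poly i (O_ y) =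
  zz * ((y == dom_pt i 0)%:R + \sum_(0 <= j < i.-1./2) (y == dom_pt i j.+1)%:R
        + \sum_(0 <= j < i.-1./2) (y == dom_pt' i j.+1)%:R).
Proof.
move=> yD; have d0 m : class_delta (glide_refl m) (O_ y) = 0.
  by apply: class_delta_neq => /esym/glide_refl_transl.
rewrite /step_poly C_E C'_E !d0 !add0r.
congr (_ * (_ + _ + _)).
- by rewrite delta_transl //; apply: (dom_pt_dominant _).1.
- apply: eq_big_nat => j; rewrite half_lt => ji; rewrite delta_transl //.
  by apply: (dom_pt_dominant _).1; lia.
- apply: eq_big_nat => j; rewrite half_lt => ji; rewrite delta_transl //.
  by apply: (dom_pt_dominant _).2; lia.
Qed.

Lemma thetaE i : theta *+ i = dom_pt i 0.
Proof. by rewrite coweightMn /dom_pt; congr pair => /=; lia. Qed.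

Lemma dom_pt_eq i j i' j' : (dom_pt i j == dom_pt i' j') = (i == i') && (j == j').
Proof.
apply/eqP/andP => [[e1 e2]|[/eqP -> /eqP ->] //].
by split; apply/eqP; move: e1 e2; lia.
Qed.

Lemma dom_pt'_eq i j i' j' : (dom_pt' i j == dom_pt' i' j') = (i == i') && (j == j').
Proof.
apply/eqP/andP => [[e1 e2]|[/eqP -> /eqP ->] //].
by split; apply/eqP; move: e1 e2; lia.
Qed.

Lemma dom_pt_pt' i j i' j' : (0 < j)%N || (0 < j')%N -> (dom_pt i j == dom_pt' i' j') = false.
Proof. by move=> jj; apply/eqP => -[e1 e2]; move: jj e1 e2; lia. Qed.

(** Inside the dominant cone, [Q_sh] discards the two boundary rays. As i theta - j alpha1 has
    coordinates (i - 2j, i + j), dominance off the walls means 2j < i; with j >= 1 this forces i >=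
    3. *)
Lemma E_setP i x : E_set (theta *+ i) x <-> exists2 j, (2 * j.+1 < i)%N & x = dom_pt i j.+1.
Proof.
have xE j : dom_pt i 0 - alpha1 *+ j = dom_pt i j.
  by rewrite coweightMn; congr pair => /=; lia.
rewrite thetaE; split=> [[[[[//|j] _ <-]] [d1 d2] [_ xN]]|[j ji ->]].
  rewrite xE in d1 d2 xN *; exists j => //.
  rewrite ltnNge; apply/negP => ij; apply: xN; exists j.+1%:Z; apply: Or31.
  by rewrite coweightMz coweightMn; move: d1 d2; rewrite /= => d1 d2; congr pair => /=; lia.
split; first split.
- by exists j.+1.
- by apply: (dom_pt_dominant _).1; lia.
split; first by apply/root_latticeE; rewrite /=; lia.
by move=> [k []]; rewrite coweightMz ?coweightMn => -[] /=; lia.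
Qed.

Lemma E'_setP i x : E'_set (theta *+ i) x <-> exists2 j, (2 * j.+1 < i)%N & x = dom_pt' i j.+1.
Proof.
have xE j : dom_pt i 0 - alpha2 *+ j = dom_pt' i j.
  by rewrite coweightMn; congr pair => /=; lia.
rewrite thetaE; split=> [[[[[//|j] _ <-]] [d1 d2] [_ xN]]|[j ji ->]].
  rewrite xE in d1 d2 xN *; exists j => //.
  rewrite ltnNge; apply/negP => ij; apply: xN; exists j.+1%:Z; apply: Or32.
  by rewrite coweightMz coweightMn; move: d1 d2; rewrite /= => d1 d2; congr pair => /=; lia.
split; first split.
- by exists j.+1.
- by apply: (dom_pt_dominant _).2; lia.
split; first by apply/root_latticeE; rewrite /=; lia.
by move=> [k []]; rewrite coweightMz ?coweightMn => -[] /=; lia.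
Qed.

Lemma sum_pt_delta i n j0 : (2 * j0.+1 < n)%N ->
  \sum_(0 <= j < i.-1./2) ((n == i) && (j0.+1 == j.+1))%:R = (i == n)%:R :> laurent.
Proof.
move=> jn; rewrite (eq_bigr (fun j => (n == i)%:R * (j == j0)%:R)); last first.
  by move=> j _; rewrite -natrM mulnb eqSS [j0 == j]eq_sym.
rewrite sum_delta /= half_lt; have [->|ni] := eqVneq i n; first by rewrite jn.
by rewrite if_same.
Qed.

Lemma step_poly_theta i n : step_poly i (O_ (dom_pt n 0)) = zz * (i == n)%:R.
Proof.
rewrite step_poly_transl ?big1_seq ?addr0; last exact: (dom_pt_dominant _).1.
- by rewrite dom_pt_eq andbT eq_sym.
- by move=> j _; rewrite dom_pt_pt' ?orbT.
- by move=> j _; rewrite dom_pt_eq andbF.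
Qed.

Lemma step_poly_pt i n j0 : (2 * j0.+1 < n)%N ->
  step_poly i (O_ (dom_pt n j0.+1)) = zz * (i == n)%:R.
Proof.
move=> jn; rewrite step_poly_transl; last by apply: (dom_pt_dominant _).1; lia.
rewrite dom_pt_eq andbF add0r [X in _ + X]big1 ?addr0; last first.
  by move=> j _; rewrite dom_pt_pt'.
by rewrite -(sum_pt_delta i jn); congr (_ * _); apply: eq_bigr => j _; rewrite dom_pt_eq.
Qed.

Lemma step_poly_pt' i n j0 : (2 * j0.+1 < n)%N ->
  step_poly i (O_ (dom_pt' n j0.+1)) = zz * (i == n)%:R.
Proof.
move=> jn; rewrite step_poly_transl; last by apply: (dom_pt_dominant _).2; lia.
rewrite eq_sym dom_pt_pt' ?orbT // add0r big1 ?add0r; last first.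
  by move=> j _; rewrite eq_sym dom_pt_pt' ?orbT.
by rewrite -(sum_pt_delta i jn); congr (_ * _); apply: eq_bigr => j _; rewrite dom_pt'_eq.
Qed.

Lemma step_poly_non_transl i O : (forall x, O <> O_ x) ->
  step_poly i O = class_delta (C_ i) O + class_delta (C'_ i) O.
Proof.
move=> ON; have d0 x : class_delta (O_ x) O = 0 by apply: class_delta_neq.
rewrite /step_poly d0; under eq_bigr do rewrite d0.
by under [X in _ + zz * (_ + X)]eq_bigr do rewrite d0; rewrite !big1_eq !addr0 mulr0 addr0.
Qed.

Lemma step_poly_glide i m : step_poly i (glide_refl (3 * m)) =
  (i%:Z == m)%:R + (i%:Z == - m)%:R.
Proof.
have dg n : class_delta (glide_refl (3 * n)) (glide_refl (3 * m)) = (m == n)%:R.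
  have [->|mn] := eqVneq m n; first exact: class_delta_id.
  by apply: class_delta_neq => /glide_refl_inj e; case/eqP: mn; lia.
rewrite step_poly_non_transl => [|x]; last exact: glide_refl_transl.
by rewrite C_E C'_E !dg eq_sym [m == _]eq_sym eqr_oppLR.
Qed.

Lemma step_poly_O2 i : step_poly i O2 = 0.
Proof.
rewrite step_poly_non_transl => [|x]; last exact: O2_transl.
by rewrite C_E C'_E !class_delta_neq ?addr0 // => /esym/glide_refl_O2.
Qed.

Lemma O1_theta0 x : class_delta O1 (O_ x) = 0.
Proof. by rewrite O1E; apply: class_delta_neq => /esym/glide_refl_transl. Qed.

Lemma O2_theta0 x : class_delta O2 (O_ x) = 0.
Proof. by apply: class_delta_neq => /esym/O2_transl. Qed.

Lemma refl_poly_theta a b n : (0 < n < b)%N ->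
  refl_poly a b (O_ (theta *+ n)) = (a - n)%:R * zz ^+ 3 + zz.
Proof.
move=> /andP[n0 nb]; rewrite thetaE refl_polyE O1_theta0 O2_theta0.
rewrite (step_poly_sum _ n0 (fun i _ => step_poly_theta i n)).
rewrite (eq_bigr (fun i => 1 * (i == n)%:R)); last first.
  move=> i _; rewrite delta_transl ?dom_pt_eq ?mul1r ?andbT 1?eq_sym //;
    exact: (dom_pt_dominant _).1.
by rewrite sum_delta n0 nb /=; ring.
Qed.

Lemma refl_poly_E a b n x : (E_set (theta *+ n) `|` E'_set (theta *+ n)) x ->
  refl_poly a b (O_ x) = (a - n)%:R * zz ^+ 3.
Proof.
move=> xE; have n0 : (0 < n)%N by case: xE => [/E_setP|/E'_setP] [j jn _]; lia.
have xD : dominant x by case: xE => [] [[]].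
have xN i : (x == dom_pt i 0) = false.
  case: xE => [/E_setP|/E'_setP] [j jn ->]; first by rewrite dom_pt_eq andbF.
  by rewrite eq_sym dom_pt_pt' ?orbT.
have stepE i : step_poly i (O_ x) = zz * (i == n)%:R.
  by case: xE => [/E_setP|/E'_setP] [j jn ->]; [apply: step_poly_pt|apply: step_poly_pt'].
rewrite refl_polyE O1_theta0 O2_theta0 (step_poly_sum _ n0 (fun i _ => stepE i)).
have -> : \sum_(1 <= i < b) class_delta (O_ (dom_pt i 0)) (O_ x) = 0.
  by apply: big1 => i _; rewrite delta_transl ?xN //; apply: (dom_pt_dominant _).1.
by ring.
Qed.

Lemma refl_poly_glide a b m : m != 0 ->
  refl_poly a b (glide_refl (3 * m)) = (a - `|m|)%:R * zz ^+ 2.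
Proof.
move=> m0; have n0 : (0 < `|m|)%N by lia.
have d1 : class_delta O1 (glide_refl (3 * m)) = 0.
  by apply: class_delta_neq; rewrite O1E => /glide_refl_inj; move: m0; lia.
have d2 : class_delta O2 (glide_refl (3 * m)) = 0.
  by apply: class_delta_neq => /glide_refl_O2.
have dt : \sum_(1 <= i < b) class_delta (O_ (dom_pt i 0)) (glide_refl (3 * m)) = 0.
  by apply: big1 => i _; apply: class_delta_neq; apply: glide_refl_transl.
(* [C_ i] and [C'_ i] have opposite nonzero glides, so exactly one of them is hit, at i = |m|. *)
have stepE i : (0 < i)%N -> step_poly i (glide_refl (3 * m)) = 1 * (i == `|m|%N)%:R.
  by move=> i0; rewrite step_poly_glide mul1r -natrD; congr (_%:R); lia.
rewrite refl_polyE d1 d2 dt (step_poly_sum _ n0 stepE).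
by move: ((a - `|m|)%:R : laurent) => c; ring.
Qed.

Lemma refl_poly_O2 a b : refl_poly a b O2 = a%:R * zz.
Proof.
have d1 : class_delta O1 O2 = 0.
  by apply: class_delta_neq; rewrite O1E => /esym/glide_refl_O2.
have dt : \sum_(1 <= i < b) class_delta (O_ (dom_pt i 0)) O2 = 0.
  by apply: big1 => i _; apply: class_delta_neq; apply: O2_transl.
have ds : \sum_(1 <= i < a) (a - i)%:R * step_poly i O2 = 0.
  by apply: big1 => i _; rewrite step_poly_O2 mulr0.
rewrite refl_polyE class_delta_id d1 dt ds.
by move: (a%:R : laurent) => c; ring.
Qed.

Lemma refl_poly_O1 a b : refl_poly a b O1 = 1.
Proof.
have d2 : class_delta O2 O1 = 0 by apply: class_delta_neq; rewrite O1E => /glide_refl_O2.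
have dt : \sum_(1 <= i < b) class_delta (O_ (dom_pt i 0)) O1 = 0.
  by apply: big1 => i _; apply: class_delta_neq; rewrite O1E; apply: glide_refl_transl.
have ds : \sum_(1 <= i < a) (a - i)%:R * step_poly i O1 = 0.
  rewrite big_nat_cond big1 // => i /andP[/andP[i0 _] _].
  rewrite O1E -[0 : int]/(3 * 0 : int) step_poly_glide oppr0.
  by case: i i0 => // i _; rewrite addr0 mulr0.
by rewrite refl_polyE class_delta_id d2 dt ds !(mulr0, addr0).
Qed.

Lemma refl_poly_other a b O :
    (forall i, (0 < i < b)%N -> O <> O_ (theta *+ i)) ->
    (forall i, (0 < i < a)%N -> O <> O_ (theta *+ i)) ->
    (forall i x, (3 <= i < a)%N ->
      (E_set (theta *+ i) `|` E'_set (theta *+ i)) x -> O <> O_ x) ->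
    (forall i, (0 < i < a)%N -> O <> C_ i /\ O <> C'_ i) ->
    O <> O2 -> O <> O1 ->
  refl_poly a b O = 0.
Proof.
move=> Nb Na NE NC /class_delta_neq d2 /class_delta_neq d1.
have dt : \sum_(1 <= i < b) class_delta (O_ (dom_pt i 0)) O = 0.
  rewrite big_nat_cond big1 // => i /andP[/Nb + _].
  by rewrite thetaE => /class_delta_neq.
have ds : \sum_(1 <= i < a) (a - i)%:R * step_poly i O = 0.
  rewrite big_nat_cond big1 // => i /andP[ia _].
  have [/class_delta_neq c0 /class_delta_neq c0'] := NC i ia.
  have := Na i ia; rewrite thetaE => /class_delta_neq d0.
  have e0 : \sum_(0 <= j < i.-1./2) class_delta (O_ (dom_pt i j.+1)) O = 0.
    rewrite big_nat_cond big1 // => j /andP[/andP[_]]; rewrite half_lt => ji _.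
    by apply/class_delta_neq/(NE i); [lia | left; apply/E_setP; exists j].
  have e0' : \sum_(0 <= j < i.-1./2) class_delta (O_ (dom_pt' i j.+1)) O = 0.
    rewrite big_nat_cond big1 // => j /andP[/andP[_]]; rewrite half_lt => ji _.
    by apply/class_delta_neq/(NE i); [lia | right; apply/E'_setP; exists j].
  by rewrite /step_poly c0 c0' d0 e0 e0' !(mulr0, addr0).
by rewrite refl_polyE d1 d2 dt ds !(mulr0, addr0).
Qed.

Theorem proposition2p15 (H : algType laurent) (T : extW -> H)
    (HT : is_hecke_algebra T) (w : extW) (k : nat) (k_gt0 : (0 < k)%N)
    (wO1 : O1 w) :
  let f := class_poly T w in
  let z := v - vinv in
  (len w = (4 * k - 1)%N ->
    (forall i, (1 <= i <= k - 1)%N ->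
       f (O_ ((alpha1 + alpha2) *+ i)) = (k - i)%:R * z ^+ 3 + z) /\
    (forall i x, (3 <= i <= k - 1)%N ->
       (E_set ((alpha1 + alpha2) *+ i) `|` E'_set ((alpha1 + alpha2) *+ i)) x ->
       f (O_ x) = (k - i)%:R * z ^+ 3) /\
    (forall i, (1 <= i <= k - 1)%N ->
       f (C_ i) = (k - i)%:R * z ^+ 2 /\ f (C'_ i) = (k - i)%:R * z ^+ 2) /\
    f O2 = k%:R * z /\
    f O1 = 1 /\
    (forall O, conj_classes O ->
       (forall i, (1 <= i <= k - 1)%N -> O <> O_ ((alpha1 + alpha2) *+ i)) ->
       (forall i x, (3 <= i <= k - 1)%N ->
          (E_set ((alpha1 + alpha2) *+ i) `|` E'_set ((alpha1 + alpha2) *+ i)) x ->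
          O <> O_ x) ->
       (forall i, (1 <= i <= k - 1)%N -> O <> C_ i /\ O <> C'_ i) ->
       O <> O2 -> O <> O1 ->
       f O = 0))
  /\
  (len w = (4 * k - 3)%N ->
    ((2 <= k)%N -> f (O_ ((alpha1 + alpha2) *+ (k - 1))) = z) /\
    (forall i, (1 <= i <= k - 2)%N ->
       f (O_ ((alpha1 + alpha2) *+ i)) = (k - 1 - i)%:R * z ^+ 3 + z) /\
    (forall i x, (3 <= i <= k - 2)%N ->
       (E_set ((alpha1 + alpha2) *+ i) `|` E'_set ((alpha1 + alpha2) *+ i)) x ->
       f (O_ x) = (k - 1 - i)%:R * z ^+ 3) /\
    (forall i, (1 <= i <= k - 2)%N ->
       f (C_ i) = (k - 1 - i)%:R * z ^+ 2 /\
       f (C'_ i) = (k - 1 - i)%:R * z ^+ 2) /\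
    f O2 = (k - 1)%:R * z /\
    f O1 = 1 /\
    (forall O, conj_classes O ->
       ((2 <= k)%N -> O <> O_ ((alpha1 + alpha2) *+ (k - 1))) ->
       (forall i, (1 <= i <= k - 2)%N -> O <> O_ ((alpha1 + alpha2) *+ i)) ->
       (forall i x, (3 <= i <= k - 2)%N ->
          (E_set ((alpha1 + alpha2) *+ i) `|` E'_set ((alpha1 + alpha2) *+ i)) x ->
          O <> O_ x) ->
       (forall i, (1 <= i <= k - 2)%N -> O <> C_ i /\ O <> C'_ i) ->
       O <> O2 -> O <> O1 ->
       f O = 0)).
Proof.
move=> f z.
have [f1 f2] := reflection_class_poly HT k_gt0 wO1.
have CE i : (0 < i)%N -> forall a b,
    refl_poly a b (C_ i) = (a - i)%:R * z ^+ 2 /\ refl_poly a b (C'_ i) = (a - i)%:R * z ^+ 2.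
  by move=> i0 a b; rewrite C_E C'_E !refl_poly_glide ?abszN //; lia.
split=> lw.
  have {f1 f2} -> : f = refl_poly k k := f1 lw.
  split; [|split; [|split; [|split; [|split]]]].
  - by move=> i ik; apply: refl_poly_theta; lia.
  - by move=> i x ik; apply: refl_poly_E.
  - by move=> i ik; apply: CE; lia.
  - exact: refl_poly_O2.
  - exact: refl_poly_O1.
  move=> O OC Nt NE NC N2 N1; apply: refl_poly_other => //.
  - by move=> i ik; apply: Nt; lia.
  - by move=> i ik; apply: Nt; lia.
  - by move=> i x ik; apply: NE; lia.
  - by move=> i ik; apply: NC; lia.
have {f1 f2} -> : f = refl_poly (k - 1) k by rewrite subn1; exact: f2 lw.
split; [|split; [|split; [|split; [|split; [|split]]]]].
(* The separate top case is the general formula at i = k - 1, which lies below the translation bound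
   k while its cubic coefficient is 0. *)
- move=> k2; have -> : z = (k - 1 - (k - 1))%:R * z ^+ 3 + z by rewrite subnn mul0r add0r.
  by apply: refl_poly_theta; lia.
- by move=> i ik; apply: refl_poly_theta; lia.
- by move=> i x ik; apply: refl_poly_E.
- by move=> i ik; apply: CE; lia.
- exact: refl_poly_O2.
- exact: refl_poly_O1.
move=> O OC N0 Nt NE NC N2 N1; apply: refl_poly_other => //.
- move=> i ik; have [e|ne] := eqVneq i (k - 1)%N; first by rewrite e; apply: N0; lia.
  by apply: Nt; lia.
- by move=> i ik; apply: Nt; lia.
- by move=> i x ik; apply: NE; lia.
- by move=> i ik; apply: NC; lia.
Qed.
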